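(* Let $j\colon V_\lambda\prec V_\lambda$ and let $M_\alpha$ denote the $\alpha$-th model of the iteration of $(V_\lambda,j)$ as defined in the context. The following are equivalent: (a) $\mathsf{I3}_\infty(j)$, that is, $M_\alpha$ is well-founded for every ordinal $\alpha$ (i.e., $j$ is iterable); (b) $\mathsf{I3}_{\omega_1}(j)$, that is, $M_{\omega_1}$ is well-founded (i.e., $j$ is $\omega_1$-iterable); (c) $\forall\beta<\omega_1\ \mathsf{I3}_\beta(j)$, that is, $M_\beta$ is well-founded for every $\beta<\omega_1$ (i.e., $j$ is $<\!\omega_1$-iterable).
   Context: Work in $\mathsf{ZFC}$. $j\colon M\prec N$ means $j$ is an elementary embedding of $M$ into $N$. For a non-identity $j\colon V_\lambda\prec V_\lambda$ with critical point $\kappa_0=\operatorname{crt}(j)$ (the least ordinal moved), its critical sequence is $\kappa_{n+1}=j(\kappa_n)$. Throughout, $j\colon V_\lambda\prec V_\lambda$ means such a non-identity embedding with $\lambda=\sup_n\kappa_n$. Extension to amenable sets. Let $M,N$ be transitive sets modelling $\mathsf{ZFC}$ and let $\pi\colon M\prec N$ be cofinal (for every ordinal $\beta\in N$ there is an ordinal $\alpha\in M$ with $\pi(\alpha)>\beta$). If $X\subseteq M$ is amenable for $M$, i.e. $X\cap(V_\alpha)^M\in M$ for all ordinals $\alpha\in M$, set $\pi^+(X)=\bigcup_{\alpha\in M\cap\mathrm{Ord}}\pi(X\cap(V_\alpha)^M)$. Iteration of $j\colon V_\lambda\prec V_\lambda$. One defines models $M_\alpha$, embeddings $j_\alpha\colon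 M_\alpha\prec M_\alpha$ (viewed as subsets of $M_\alpha$, i.e. sets of ordered pairs) and commuting embeddings $j_{\beta,\alpha}\colon M_\beta\prec M_\alpha$ ($\beta\le\alpha$) by recursion: $M_0=V_\lambda$, $j_0=j$, $j_{0,0}=\mathrm{id}$; $M_{\alpha+1}=M_\alpha$, $j_{\alpha,\alpha+1}=j_\alpha$, $j_{\beta,\alpha+1}=j_\alpha\circ j_{\beta,\alpha}$, and $j_{\alpha+1}=j_\alpha^+(j_\alpha)$; for $\gamma$ limit, $M_\gamma$ with the maps $j_{\beta,\gamma}$ is the direct limit of the system $(M_\alpha,j_{\beta,\alpha})_{\beta\le\alpha<\gamma}$. If $M_\gamma$ is well-founded it is identified with its transitive collapse, $j_\gamma=j_{0,\gamma}^+(j)$, and the construction continues; otherwise the construction stops. ''$M_\alpha$ is well-founded'' means that the construction reaches stage $\alpha$ and $M_\alpha$ is well-founded. $j$ is $\alpha$-iterable, written $\mathsf{I3}_\alpha(j)$, if $M_{\omega\cdot\alpha}$ is well-founded; $<\!\alpha$-iterable if $M_{\omega\cdot\beta}$ is well-founded for all $\beta<\alpha$; iterable, written $\mathsf{I3}_\infty(j)$, if it is $\alpha$-iterable for every ordinal $\alpha$. *)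

(* Defs.v *)
From mathcomp Require Import all_boot.
From mathcomp Require Import boolp.

Set Implicit Arguments.
Unset Strict Implicit.
Unset Printing Implicit Defensive.

(* The universe of sets: Aczel's well-founded trees, quotiented by extensional
   equality so that Leibniz equality on [V] is equality of sets.  The lemmas
   below show that the axioms of ZFC hold in [V]; the axiom of choice is
   inherited from boolp. *)

Inductive Ens : Type := sup : forall A : Type, (A -> Ens) -> Ens.

Fixpoint EQ (x y : Ens) : Prop :=
  let: sup A f := x in let: sup B g := y in
  (forall a, exists b, EQ (f a) (g b)) /\ (forall b, exists a, EQ (f a) (g b)).

Definition IN (x y : Ens) : Prop := let: sup B g := y in exists b, EQ x (g b).

Lemma EQ_refl x : EQ x x.
Proof. by elim: x => A f IH; split=> a; exists a. Qed.

Lemma EQ_sym x y : EQ x y -> EQ y x.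
Proof.
elim: x y => A f IH [B g] [H1 H2]; split=> [b|a].
- by have [a /IH ?] := H2 b; exists a.
- by have [b /IH ?] := H1 a; exists b.
Qed.

Lemma EQ_trans y x z : EQ x y -> EQ y z -> EQ x z.
Proof.
elim: x y z => A f IH [B g] [C h] [H1 H2] [H3 H4]; split=> [a|c].
- by have [b ab] := H1 a; have [c bc] := H3 b; exists c; apply: IH bc.
- by have [b bc] := H4 c; have [a ab] := H2 b; exists a; apply: IH bc.
Qed.

Definition V : Type := {P : Ens -> Prop | exists x, P = EQ x}.

Definition cl (x : Ens) : V := exist _ (EQ x) (ex_intro _ x erefl).

Definition inV (X Y : V) : Prop :=
  exists x y, [/\ X = cl x, Y = cl y & IN x y].

Notation "x ∈ y" := (inV x y) (at level 70, no associativity).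

Definition subV (x y : V) : Prop := forall z, z ∈ x -> z ∈ y.

Notation "x ⊆ y" := (subV x y) (at level 70, no associativity).

Lemma cl_eq x y : cl x = cl y <-> EQ x y.
Proof.
split=> [H|xy].
  have: sval (cl x) = sval (cl y) by rewrite H.
  by move=> /= ->; exact: EQ_refl.
apply: eq_exist => /=; apply/funext => z; apply/propext; split=> H.
- exact: EQ_trans (EQ_sym xy) H.
- exact: EQ_trans xy H.
Qed.

Lemma cl_surj (X : V) : exists x, X = cl x.
Proof. by case: X => P [x Px]; exists x; apply: eq_exist. Qed.

Lemma mem_cl x y : cl x ∈ cl y <-> IN x y.
Proof.
split=> [[x' [y' [/cl_eq xx' /cl_eq yy']]]|xy]; last by exists x, y.
case: y y' yy' => B g [B' g'] [_ H] [b' x'b'].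
have [b bb'] := H b'; exists b.
exact: EQ_trans xx' (EQ_trans x'b' (EQ_sym bb')).
Qed.

Lemma V_ext (x y : V) : (forall z, z ∈ x <-> z ∈ y) -> x = y.
Proof.
have [[A f] ->] := cl_surj x; have [[B g] ->] := cl_surj y => H.
apply/cl_eq; split=> [a|b].
- have /H/mem_cl [b ?] : cl (f a) ∈ cl (sup f).
    by apply/mem_cl; exists a; exact: EQ_refl.
  by exists b.
- have /H/mem_cl [a ?] : cl (g b) ∈ cl (sup g).
    by apply/mem_cl; exists b; exact: EQ_refl.
  by exists a; exact: EQ_sym.
Qed.

Lemma inV_wf : well_founded inV.
Proof.
move=> X; have [x ->{X}] := cl_surj X.
elim: x => A f IH; constructor=> Y; have [y ->{Y}] := cl_surj Y.
by move=> /mem_cl [a /cl_eq ->].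
Qed.

Lemma V_inhabited : inhabited V.
Proof. by constructor; exact: cl (@sup False (fun f => match f with end)). Qed.

(* Definite description; an arbitrary set when nothing satisfies [P]. *)
Definition the (P : V -> Prop) : V :=
  match pselect (exists x, P x) with
  | left h => sval (cid h)
  | right _ => cl (@sup False (fun f => match f with end))
  end.

Lemma theP (P : V -> Prop) : (exists x, P x) -> P (the P).
Proof. by rewrite /the; case: pselect => // h _; case: (cid h). Qed.

(* [setof P] is the set {x | P x}; it is only meaningful when the class [P] is
   a set, see [mem_setof]. *)
Definition setof (P : V -> Prop) : V := the (fun x => forall z, z ∈ x <-> P z).

Lemma mem_setof (A : Type) (f : A -> Ens) (P : V -> Prop) :
  (forall z, P z -> exists a, z = cl (f a)) -> forall z, z ∈ setof P <-> P z.
Proof.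
move=> Pf; apply: (@theP (fun x => forall z, z ∈ x <-> P z)).
exists (cl (@sup {a | P (cl (f a))} (fun s => f (sval s)))) => z.
split=> [|Pz].
  by have [x ->] := cl_surj z => /mem_cl [[a Pa] /cl_eq ->].
have [a za] := Pf z Pz; rewrite za in Pz *; apply/mem_cl.
by exists (exist _ a Pz); exact: EQ_refl.
Qed.

Lemma replacement (a : V) (F : V -> V) (P : V -> Prop) :
  (forall z, P z -> exists2 x, x ∈ a & z = F x) ->
  forall z, z ∈ setof P <-> P z.
Proof.
have [[A f] ->] := cl_surj a => PF.
apply: (@mem_setof A (fun i => sval (cid (cl_surj (F (cl (f i))))))).
move=> z /PF [x]; have [y ->] := cl_surj x => /mem_cl [i /cl_eq ->] ->.
by exists i; case: cid.
Qed.

Lemma separation (a : V) (P : V -> Prop) :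
  (forall z, P z -> z ∈ a) -> forall z, z ∈ setof P <-> P z.
Proof. by move=> Pa; apply: (@replacement a id) => z /Pa ?; exists z. Qed.

Lemma powerset (a : V) z : z ∈ setof (fun x => x ⊆ a) <-> z ⊆ a.
Proof.
have [[A f] ->] := cl_surj a; move: z.
apply: (@mem_setof (A -> Prop) (fun Q => @sup {i | Q i} (fun s => f (sval s)))).
move=> z za; exists (fun i => cl (f i) ∈ z); apply: V_ext => y.
have [x ->] := cl_surj y; split=> [xz|/mem_cl [[i Qi] /cl_eq ->] //].
have /mem_cl [i xi] := za _ xz.
have Qi : cl (f i) ∈ z by rewrite -(proj2 (cl_eq _ _) xi).
by apply/mem_cl; exists (exist _ i Qi).
Qed.

Lemma union (a : V) (F : V -> V) z :
  z ∈ setof (fun z => exists2 x, x ∈ a & z ∈ F x) <->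
  exists2 x, x ∈ a & z ∈ F x.
Proof.
have [[A f] ->] := cl_surj a; move: z.
pose r i := sval (cid (cl_surj (F (cl (f i))))).
pose dom x := let: sup B _ := x in B.
pose br x : dom x -> Ens := let: sup B g := x in g.
apply: (@mem_setof {i : A & dom (r i)} (fun s => br _ (projT2 s))).
move=> z [x]; have [y ->] := cl_surj x => /mem_cl [i /cl_eq ->].
have Er : F (cl (f i)) = cl (r i) by rewrite /r; case: cid.
have [w ->] := cl_surj z; rewrite Er => wr.
have [b wb] : exists b : dom (r i), EQ w (br _ b).
  by move: wr => /mem_cl; case: (r i).
by exists (existT _ i b); apply/cl_eq.
Qed.

Definition emptyV : V := setof (fun _ => False).
Definition upair (x y : V) : V := setof (fun z => z = x \/ z = y).
Definition opair (x y : V) : V := upair (upair x x) (upair x y).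

Lemma mem_emptyV z : ~ z ∈ emptyV.
Proof. by rewrite /emptyV (@mem_setof False (fun f => match f with end)). Qed.

Lemma mem_upair x y z : z ∈ upair x y <-> z = x \/ z = y.
Proof.
move: z; have [a ->] := cl_surj x; have [b ->] := cl_surj y.
apply: (@mem_setof bool (fun i : bool => if i then a else b)) => z [] ->.
- by exists true.
- by exists false.
Qed.

Lemma opair_inj x y x' y' : opair x y = opair x' y' -> x = x' /\ y = y'.
Proof.
have upx u v w : upair u u = upair v w -> u = v /\ u = w.
  move=> E; have /mem_upair: v ∈ upair u u by rewrite E mem_upair; left.
  have /mem_upair: w ∈ upair u u by rewrite E mem_upair; right.
  by move=> [->|->] [->|->].
move=> E.
have xx' : x = x'.
  have /mem_upair [/upx[]//|/upx[]//] : upair x x ∈ opair x' y'.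
  by rewrite -E mem_upair; left.
subst x'; split=> //.
have /mem_upair [F|F] : upair x y ∈ opair x y' by rewrite -E mem_upair; right.
- have [xx xy] := upx _ _ _ (esym F); subst y.
  have /mem_upair [/esym/upx[] //|/esym/upx[] //] : upair x y' ∈ opair x x.
  by rewrite E mem_upair; right.
- have /mem_upair [yx|//] : y ∈ upair x y' by rewrite -F mem_upair; right.
  subst y; have /mem_upair [/esym|/esym] : y' ∈ upair x x.
    by rewrite F mem_upair; right.
  all: by [].
Qed.

(* Functions as sets of ordered pairs. *)

Definition is_fun (f M N : V) : Prop :=
  (forall p, p ∈ f -> exists x y, [/\ x ∈ M, y ∈ N & p = opair x y]) /\
  (forall x, x ∈ M -> exists! y, opair x y ∈ f).

Definition app (f x : V) : V := the (fun y => opair x y ∈ f).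

(* Ordinals. *)

Definition transitive_set (x : V) : Prop := forall y, y ∈ x -> y ⊆ x.

Definition is_ordinal (x : V) : Prop :=
  transitive_set x /\ forall y, y ∈ x -> transitive_set y.

Definition succV (x : V) : V := setof (fun z => z ∈ x \/ z = x).

Lemma mem_succV x z : z ∈ succV x <-> z ∈ x \/ z = x.
Proof.
apply: (@separation (setof (fun w =>
  exists2 y, y ∈ upair x (upair x x) & w ∈ y))) => w.
move=> [wx|->]; apply/union; [exists x | exists (upair x x)] => //;
  apply/mem_upair; by [left|right].
Qed.

Lemma succV_inj x y : succV x = succV y -> x = y.
Proof.
have asym z : Acc inV z -> forall w, z ∈ w -> ~ w ∈ z.
  by elim=> u _ IH w uw wu; exact: (IH w wu u wu uw).
move=> E.
have /mem_succV [xy|//] : x ∈ succV y by rewrite -E mem_succV; right.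
have /mem_succV [yx|//] : y ∈ succV x by rewrite E mem_succV; right.
by case: (asym _ (inV_wf x) _ xy).
Qed.

Definition omega : V := setof (fun x => exists n : nat, x = iter n succV emptyV).

Lemma mem_omega x : x ∈ omega <-> exists n : nat, x = iter n succV emptyV.
Proof.
move: x; apply: (@mem_setof nat
  (fun n => sval (cid (cl_surj (iter n succV emptyV))))) => _ [n ->].
by exists n; case: cid.
Qed.

Definition countable (x : V) : Prop :=
  exists f : V -> nat, forall y z, y ∈ x -> z ∈ x -> f y = f z -> y = z.

Definition omega1 : V := setof (fun x => is_ordinal x /\ countable x).

Lemma mem_omega1 x : x ∈ omega1 <-> is_ordinal x /\ countable x.
Proof.
pose node (R : nat -> nat -> Prop) (wR : well_founded R) : nat -> Ens :=
  Fix wR (fun _ => Ens) (fun n rec =>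
    @sup {m | R m n} (fun s => rec (sval s) (proj2_sig s))).
have nodeE R wR n :
    @node R wR n = @sup {m | R m n} (fun s => @node R wR (sval s)).
  rewrite {1}/node Fix_eq // => k g g' gg'; congr sup.
  by apply/funext => s; rewrite gg'.
move: x; apply: (@mem_setof
  {P : nat -> Prop & {R : nat -> nat -> Prop | well_founded R}}
  (fun a => @sup {n | projT1 a n}
              (fun s => node _ (proj2_sig (projT2 a)) (sval s)))).
move=> x [[tx _] [f f_inj]].
pose R m n := exists y z, [/\ y ∈ z, y ∈ x, z ∈ x, f y = m & f z = n].
have wR : well_founded R.
  have acc z : z ∈ x -> Acc R (f z).
    elim/(well_founded_ind inV_wf): z => z IH zx; constructor=> m.
    move=> [y [z' [yz' yx z'x <- /(f_inj _ _ z'x zx) zz']]]; apply: IH => //.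
    by rewrite -zz'.
  by move=> n; constructor=> m [y [z [_ yx _ <- _]]]; exact: acc.
have nodef z : z ∈ x -> cl (node R wR (f z)) = z.
  elim/(well_founded_ind inV_wf): z => z IH zx; apply: V_ext => w.
  rewrite nodeE; split=> [|wz].
    have [v ->] := cl_surj w => /mem_cl [[m Rm] /= /cl_eq ->].
    case: Rm => y [z' [yz' yx z'x <- /(f_inj _ _ z'x zx) zz']].
    by rewrite zz' in yz'; rewrite IH.
  have wx : w ∈ x by exact: tx zx _ wz.
  have Rw : R (f w) (f z) by exists w, z.
  rewrite -(IH w wz wx); apply/mem_cl.
  by exists (exist _ (f w) Rw); exact: EQ_refl.
pose P n := exists2 z, z ∈ x & f z = n.
exists (existT _ P (exist _ R wR)); apply: V_ext => w; split=> [wx|].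
  have Pw : P (f w) by exists w.
  rewrite -(nodef w wx); apply/mem_cl.
  by exists (exist _ (f w) Pw); exact: EQ_refl.
have [v ->] := cl_surj w => /mem_cl [[n Pn] /= /cl_eq ->].
by case: Pn => z zx <-; rewrite nodef.
Qed.

(* ∈-recursion: [F] receives the values already computed at the elements of
   the argument ([None] elsewhere). *)
Definition memrec (T : Type) (F : (V -> option T) -> V -> T) : V -> T :=
  Fix inV_wf (fun _ => T) (fun x rec =>
    F (fun y => match pselect (y ∈ x) with
                | left h => Some (rec y h)
                | right _ => None
                end) x).

Lemma memrecE (T : Type) (F : (V -> option T) -> V -> T) x :
  memrec F x =
  F (fun y => if pselect (y ∈ x) then Some (memrec F y) else None) x.
Proof.
rewrite {1}/memrec Fix_eq => [|y f g fg].
  by congr F; apply/funext => y; case: pselect.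
by congr F; apply/funext => z; case: pselect => // h; rewrite fg.
Qed.

Definition recV (F : (V -> V) -> V -> V) : V -> V :=
  memrec (fun rec => F (fun y => odflt emptyV (rec y))).

Lemma recVE F x :
  recV F x = F (fun y => if pselect (y ∈ x) then recV F y else emptyV) x.
Proof.
rewrite /recV memrecE; congr F; apply/funext => y.
by case: pselect.
Qed.

(* a + b = a ∪ {a + c : c < b}. *)
Definition ordadd (a : V) : V -> V :=
  recV (fun add b => setof (fun z => z ∈ a \/ exists2 c, c ∈ b & z = add c)).

Lemma mem_ordadd a b z :
  z ∈ ordadd a b <-> z ∈ a \/ exists2 c, c ∈ b & z = ordadd a c.
Proof.
pose t := setof (fun w => exists2 c, c ∈ b & w = ordadd a c).
have tE w : w ∈ t <-> exists2 c, c ∈ b & w = ordadd a c.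
  exact: (@replacement b (ordadd a)).
rewrite {1}/ordadd recVE; set P := (X in setof X).
have PE w : P w <-> w ∈ a \/ exists2 c, c ∈ b & w = ordadd a c.
  rewrite /P; split=> -[wa|[c cb wc]]; try by left.
    by right; exists c => //; move: wc; case: pselect.
  by right; exists c => //; case: pselect.
rewrite -PE.
apply: (@separation (setof (fun w => exists2 x, x ∈ upair a t & w ∈ x))) => w.
by move=> /PE [wa|/tE wt]; apply/union; [exists a|exists t] => //;
   apply/mem_upair; [left|right].
Qed.

(* a * b = sup {a * c + a : c < b}. *)
Definition ordmul (a : V) : V -> V :=
  recV (fun mul b => setof (fun z => exists2 c, c ∈ b & z ∈ ordadd (mul c) a)).

Lemma mem_ordmul a b z :
  z ∈ ordmul a b <-> exists2 c, c ∈ b & z ∈ ordadd (ordmul a c) a.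
Proof.
rewrite {1}/ordmul recVE -(@union b (fun c => ordadd (ordmul a c) a)).
set t := setof _; set t' := setof _; suff -> : t = t' by [].
congr setof; apply/funext => w; apply/propext.
by split=> -[c cb wc]; exists c => //; move: wc; case: pselect.
Qed.

(* The cumulative hierarchy relativized to the class [M]:
   (V_a)^M = ⋃_{b<a} P((V_b)^M) ∩ M. *)
Definition Vrel (M : V -> Prop) : V -> V :=
  recV (fun Vb a => setof (fun x => M x /\ exists2 b, b ∈ a & x ⊆ Vb b)).

Lemma mem_Vrel M a x :
  x ∈ Vrel M a <-> M x /\ exists2 b, b ∈ a & x ⊆ Vrel M b.
Proof.
rewrite {1}/Vrel recVE; set P := (X in setof X).
have PE w : P w <-> M w /\ exists2 b, b ∈ a & w ⊆ Vrel M b.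
  rewrite /P; split=> -[Mw [b ba wb]]; split=> //;
    by exists b => //; move: wb; case: pselect.
rewrite -PE.
pose F b := setof (fun x => x ⊆ Vrel M b).
apply: (@separation (setof (fun w => exists2 b, b ∈ a & w ∈ F b))) => w.
by move=> /PE [_ [b ba wb]]; apply/union; exists b => //; apply/powerset.
Qed.

Definition Vset : V -> V := Vrel (fun _ => True).

(* First-order formulas in the language {∈}, with variables indexed by nat,
   and Tarskian satisfaction in the structure (M, ∈). *)

Inductive form : Type :=
| FMem of nat & nat
| FEq of nat & nat
| FNot of form
| FAnd of form & form
| FAll of nat & form.

Fixpoint sat (M : V) (e : nat -> V) (phi : form) : Prop :=
  match phi with
  | FMem i k => e i ∈ e k
  | FEq i k => e i = e k
  | FNot p => ~ sat M e p
  | FAnd p q => sat M e p /\ sat M e q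
  | FAll i p => forall x, x ∈ M -> sat M (fun n => if n == i then x else e n) p
  end.

Definition elementary (f M N : V) : Prop :=
  is_fun f M N /\
  forall (phi : form) (e : nat -> V), (forall n, e n ∈ M) ->
    (sat M e phi <-> sat N (fun n => app f (e n)) phi).

Definition is_crt (j lam k : V) : Prop :=
  [/\ is_ordinal k, k ∈ Vset lam, app j k <> k &
      forall x, x ∈ k -> app j x = x].

Definition I3_embedding (lam j : V) : Prop :=
  [/\ is_ordinal lam,
      elementary j (Vset lam) (Vset lam) &
      exists2 k, is_crt j lam k &
        forall x, x ∈ lam <-> exists n : nat, x ∈ iter n (app j) k].

(* The extension π⁺(X) of π : M ≺ N to X ⊆ M amenable for M. *)
Definition extend (M : V) (pi : V -> V) (X : V) : V :=
  setof (fun z => exists a, [/\ a ∈ M, is_ordinal a &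
    z ∈ pi (setof (fun x => x ∈ X /\ x ∈ Vrel (fun y => y ∈ M) a))]).

(* Stage α of the iteration: M_α, j_α and β ↦ j_{β,α}.  The map j_{β,α} is
   only meaningful for β ≤ α and on M_β. *)
Record Stage : Type := MkStage {
  model : V;
  emb : V;
  bond : V -> V -> V
}.

(* The direct limit of the system [S] below the limit ordinal [g], as the type
   of sets of pairs (b, x) with x ∈ M_b; its elements are the classes
   [dl_class]. *)
Definition dl_point (S : V -> Stage) (g : V) (p : V * V) : Prop :=
  p.1 ∈ g /\ p.2 ∈ model (S p.1).

Definition dl_rel (S : V -> Stage) (g : V) (R : V -> V -> Prop)
    (p q : V * V) : Prop :=
  [/\ dl_point S g p, dl_point S g q &
      exists d, [/\ d ∈ g, p.1 ⊆ d, q.1 ⊆ d &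
                    R (bond (S d) p.1 p.2) (bond (S d) q.1 q.2)]].

Definition dl_class (S : V -> Stage) (g : V) (p : V * V) : V * V -> Prop :=
  dl_rel S g eq p.

Definition dl_mem (S : V -> Stage) (g : V) (c d : V * V -> Prop) : Prop :=
  exists p q,
    [/\ c = dl_class S g p, d = dl_class S g q & dl_rel S g inV p q].

(* Mostowski collapse. *)
Definition dl_collapse (S : V -> Stage) (g : V)
    (wf : well_founded (dl_mem S g)) : (V * V -> Prop) -> V :=
  Fix wf (fun _ => V) (fun c rec =>
    setof (fun z => exists d (h : dl_mem S g d c), z = rec d h)).

Lemma dl_collapseE (S : V -> Stage) (g : V) (wf : well_founded (dl_mem S g)) c :
  dl_collapse wf c =
  setof (fun z => exists2 d, dl_mem S g d c & z = dl_collapse wf d).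
Proof.
rewrite /dl_collapse Fix_eq => [|x f f' ff'].
  congr setof; apply/funext => z; apply/propext.
  by split=> [[d [h zd]]|[d h zd]]; exists d => //; exists h.
congr setof; apply/funext => z; apply/propext.
by split=> -[d [h zd]]; exists d, h; rewrite zd ff'.
Qed.

Definition stage0 (lam j : V) : Stage := MkStage (Vset lam) j (fun _ x => x).

(* From stage b to stage a = b + 1. *)
Definition stage_succ (s : Stage) (a : V) : Stage :=
  MkStage (model s)
          (extend (model s) (app (emb s)) (emb s))
          (fun b x => if pselect (b = a) then x else app (emb s) (bond s b x)).

Definition stage_limit (S : V -> Stage) (g : V)
    (wf : well_founded (dl_mem S g)) (lam j : V) : Stage :=
  let pi b x := dl_collapse wf (dl_class S g (b, x)) in
  MkStage (setof (fun z => exists b x, dl_point S g (b, x) /\ z = pi b x))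
          (extend (Vset lam) (pi emptyV) j)
          (fun b x => if pselect (b = g) then x else pi b x).

(* [prev] gives the earlier stages, [None] standing for "not constructed". *)
Definition stage_step (lam j : V) (prev : V -> option Stage) (a : V) :
    option Stage :=
  let S b := odflt (stage0 lam j) (prev b) in
  if pselect (a = emptyV) then Some (stage0 lam j)
  else match pselect (exists b, a = succV b) with
  | left h => omap (fun s => stage_succ s a) (prev (sval (cid h)))
  | right _ =>
      if pselect (forall b, b ∈ a -> prev b) then
        match pselect (well_founded (dl_mem S a)) with
        | left wf => Some (stage_limit wf lam j)
        | right _ => None
        end
      else None
  end.

(* [stage lam j a] is [Some s] if the iteration of (V_lam, j) reaches [a] and
   the a-th model is well-founded (and then [s] is the a-th stage, with that
   model replaced by its transitive collapse); it is [None] otherwise. *)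
Definition stage (lam j : V) : V -> option Stage :=
  memrec (fun rec => stage_step lam j (fun b => obind id (rec b))).

Lemma stageE lam j a :
  stage lam j a =
  stage_step lam j (fun b => if pselect (b ∈ a) then stage lam j b else None) a.
Proof.
rewrite {1}/stage memrecE; congr stage_step; apply/funext => b.
by case: (pselect (b ∈ a)).
Qed.

Lemma stage_emptyV lam j : stage lam j emptyV = Some (stage0 lam j).
Proof. by rewrite stageE /stage_step; case: (pselect (emptyV = emptyV)). Qed.

Lemma stage_succV lam j b :
  stage lam j (succV b) =
  omap (fun s => stage_succ s (succV b)) (stage lam j b).
Proof.
rewrite stageE /stage_step.
have bS : b ∈ succV b by apply/mem_succV; right.
have nE : succV b <> emptyV by move=> E; rewrite E in bS; exact: mem_emptyV bS.
case: (pselect (succV b = emptyV)) => [//|_ /=].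
case: (pselect (exists c, succV b = succV c)) => [h|[]]; last by exists b.
rewrite -(succV_inj (svalP (cid h))).
by case: (pselect (b ∈ succV b)).
Qed.

Lemma stage_limitE lam j g :
  g <> emptyV -> ~ (exists b, g = succV b) ->
  let prev b := if pselect (b ∈ g) then stage lam j b else None in
  let S b := odflt (stage0 lam j) (prev b) in
  (forall s, stage lam j g = Some s <->
    (forall b, b ∈ g -> stage lam j b) /\
    exists wf : well_founded (dl_mem S g), s = stage_limit wf lam j).
Proof.
move=> g0 gS prev S s; rewrite stageE -/prev /stage_step -/S.
case: (pselect (g = emptyV)) => [E|_ /=]; first by case: g0.
case: (pselect (exists b, g = succV b)) => [E|_]; first by case: gS.
have prevE : (forall b, b ∈ g -> prev b) <-> (forall b, b ∈ g -> stage lam j b).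
  rewrite /prev; split=> H b bg; move: (H b bg).
    by case: (pselect (b ∈ g)).
  by case: (pselect (b ∈ g)).
case: (pselect (forall b, b ∈ g -> prev b)) => /= H; last first.
  by split=> // -[/prevE].
case: (pselect (well_founded _)) => wf.
  split=> [[<-]|[_ [wf' ->]]]; first by split; [apply/prevE|exists wf].
  by rewrite (Prop_irrelevance wf' wf).
by split=> // -[_ [wf']]; case: wf.
Qed.

Definition model_wf (lam j a : V) : Prop := stage lam j a.

Definition I3 (lam j a : V) : Prop := model_wf lam j (ordmul omega a).

Definition I3_infty (lam j : V) : Prop := forall a, is_ordinal a -> I3 lam j a.

(* Main.v *)
From HB Require Import structures.
Require Import Defs.
From mathcomp Require Import all_boot zify.
From mathcomp Require Import boolp.

(** The reason for the equivalence is that an element of an iterate depends on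
    finitely many steps of the iteration only.

    Write L for V_λ, let J_0 = j and let J_(n+1) = j⁺(J_n) be the result of
    applying j to J_n.  Every J_n is an elementary embedding of L, because a
    statement about all x of rank below y and their images J_n(x) is a
    statement about one element of L, the piece of the graph of J_n inside V_y,
    and j transfers it.  The same argument gives J_m⁺(J_l) = J_(l+1) for m <= l
    ([iterate_graph]), hence J_m ∘ J_l = J_(l+1) ∘ J_m ([iterate_comm]).  These
    are the relations between the maps that insert a new element into a finite
    linear order, J_m inserting it above exactly m old ones.  So L becomes a
    functor on finite linear orders and strictly increasing maps: inserting e
    into a finite set E of ordinals acts by J_m, where m is the number of
    elements of E below e, and the order of several insertions does not matter
    ([act_perm]).

    For an ordinal a, the direct limit of copies of L over the finite subsets
    of a is the a-th iterate.  It is described here by points (E, x), standing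
    for the image of x in L under the insertions that turn the empty order on
    E into a, and by the relation [ptmem] between them.  By induction on a, the
    construction reaches a well-founded stage a if and only if [ptmem a] is
    well-founded, and the model, the embedding and the connecting maps of that
    stage are those of the finite-support limit ([stage_describes]): in the
    successor step from b to b + 1 a support can be enlarged by b, which acts
    as the embedding of stage b, and in the limit step every finite support is
    already bounded.

    Well-foundedness of [ptmem a] descends to smaller ordinals.  Conversely, a
    descending sequence of points of a has countably many ordinals in its
    supports; replacing these by their positions in the order that they form
    gives a descending sequence of points of a countable ordinal
    ([ptmem_wf_countable]).  So well-foundedness at all countable stages yields
    it at all stages.  Since ω·a is an ordinal that includes a, this proves
    each of the claimed equivalences. *)

Set Implicit Arguments.
Unset Strict Implicit.
Unset Printing Implicit Defensive.

(** * Ordinals and the cumulative hierarchy *)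

Lemma inV_irrefl x : ~ x ∈ x.
Proof. by elim/(well_founded_ind inV_wf): x => x IH xx; exact: (IH x xx xx). Qed.

Lemma inV_asym x y : x ∈ y -> ~ y ∈ x.
Proof.
elim/(well_founded_ind inV_wf): x y => x IH y xy yx.
by case: (IH y yx x yx xy).
Qed.

Lemma subV_anti x y : x ⊆ y -> y ⊆ x -> x = y.
Proof. by move=> xy yx; apply: V_ext => z; split; [exact: xy|exact: yx]. Qed.

Lemma ord_in x y : is_ordinal x -> y ∈ x -> is_ordinal y.
Proof.
move=> [tx hx] yx; split; first exact: hx.
by move=> z zy; apply: hx; exact: tx zy.
Qed.

Lemma ord_trans x y z : is_ordinal x -> z ∈ y -> y ∈ x -> z ∈ x.
Proof. by move=> [tx _] zy yx; exact: tx yx _ zy. Qed.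

Lemma ord_trichotomy x y :
  is_ordinal x -> is_ordinal y -> [\/ x ∈ y, x = y | y ∈ x].
Proof.
elim/(well_founded_ind inV_wf): x y => x IHx y ox.
elim/(well_founded_ind inV_wf): y => y IHy oy.
have [xy|/existsNP [u /not_implyP [ux nuy]]] := pselect (x ⊆ y).
  have [yx|/existsNP [v /not_implyP [vy nvx]]] := pselect (y ⊆ x).
    by apply: Or32; exact: subV_anti.
  case: (IHy v vy (ord_in oy vy)) => [xv|xv|//].
    by apply: Or31; exact: ord_trans xv vy.
  by apply: Or31; rewrite xv.
case: (IHx u ux y (ord_in ox ux) oy) => [//|uy|yu].
  by apply: Or33; rewrite -uy.
by apply: Or33; exact: ord_trans yu ux.
Qed.

Lemma ord_sub x y : is_ordinal x -> is_ordinal y -> x ⊆ y -> x ∈ y \/ x = y.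
Proof.
move=> ox oy xy; case: (ord_trichotomy ox oy) => [|->|yx]; [by left|by right|].
by case: (@inV_irrefl y); exact: xy.
Qed.

Lemma succV_ord x : is_ordinal x -> is_ordinal (succV x).
Proof.
move=> ox; split=> y /mem_succV.
  move=> [yx|->] z zy; apply/mem_succV; left => //.
  exact: ord_trans yx.
by case=> [yx|->]; [have [] := ord_in ox yx|have [] := ox].
Qed.

Lemma emptyV_ord : is_ordinal emptyV.
Proof. by split=> y /mem_emptyV. Qed.

Lemma emptyVP x : x <> emptyV -> exists y, y ∈ x.
Proof.
move=> x0; apply: contrapT => nex; apply: x0; apply: V_ext => z.
by split=> [zx|/mem_emptyV//]; case: nex; exists z.
Qed.

Lemma succV_in_limit g e : is_ordinal g -> ~ (exists b, g = succV b) ->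
  e ∈ g -> succV e ∈ g.
Proof.
move=> og gS eg; have oe := ord_in og eg.
case: (ord_trichotomy (succV_ord oe) og) => [//|E|/mem_succV []].
- by case: gS; exists e.
- by move=> /inV_asym; case.
- by move=> E; rewrite E in eg; case: (inV_irrefl eg).
Qed.

(** The hierarchy is used at arbitrary sets [a], not only at ordinals: [Vset a]
    is then the level indexed by the rank of [a], so that ranks need not be
    mentioned. *)
Lemma mem_Vset a x : x ∈ Vset a <-> exists2 b, b ∈ a & x ⊆ Vset b.
Proof. by rewrite /Vset mem_Vrel; split=> [[]|]. Qed.

Lemma Vset_sub a x y : x ∈ Vset a -> y ⊆ x -> y ∈ Vset a.
Proof.
by move=> /mem_Vset [b ba xb] yx; apply/mem_Vset; exists b => // z /yx; exact: xb.
Qed.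

Lemma Vset_trans a : transitive_set (Vset a).
Proof.
elim/(well_founded_ind inV_wf): a => a IH x /mem_Vset [b ba xb] y /xb yb.
by apply/mem_Vset; exists b => //; exact: IH.
Qed.

Lemma Vset_in a b : b ∈ a -> Vset b ∈ Vset a.
Proof. by move=> ba; apply/mem_Vset; exists b. Qed.

Lemma Vset_in_sub a b : b ∈ a -> Vset b ⊆ Vset a.
Proof. by move=> /Vset_in; exact: Vset_trans. Qed.

Lemma Vset_self a : a ⊆ Vset a.
Proof.
elim/(well_founded_ind inV_wf): a => a IH y ya.
by apply/mem_Vset; exists y => //; exact: IH.
Qed.

Lemma Vset_mono a b : b ⊆ Vset a -> Vset b ⊆ Vset a.
Proof.
elim/(well_founded_ind inV_wf): a b => a IH b ba z /mem_Vset [c cb zc].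
have /mem_Vset [d da cd] := ba _ cb.
by apply/mem_Vset; exists d => // w /zc; exact: IH.
Qed.

Definition sing x := upair x x.

Lemma mem_sing x y : y ∈ sing x <-> y = x.
Proof. by rewrite mem_upair; split=> [[]|->]; [..|left]. Qed.

Lemma upair_Vset a b x y : x ∈ Vset a -> y ∈ Vset a -> a ∈ b -> upair x y ∈ Vset b.
Proof. by move=> xa ya ab; apply/mem_Vset; exists a => // z /mem_upair [->|->]. Qed.

Lemma opair_Vset a x y : x ∈ Vset a -> y ∈ Vset a ->
  opair x y ∈ Vset (sing (sing a)).
Proof.
move=> xa ya; have s z : z ∈ sing z by apply/mem_sing.
by apply: (upair_Vset (a := sing a)) => //; apply: (upair_Vset (a := a)).
Qed.

Lemma omega_ord : is_ordinal omega.
Proof.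
have oi n : is_ordinal (iter n succV emptyV).
  by elim: n => [|n IH]; [exact: emptyV_ord|exact: succV_ord].
split=> y /mem_omega [n ->]; last by have [] := oi n.
elim: n => [|n IH] z /=; first by move=> /mem_emptyV.
by move=> /mem_succV [/IH//|->]; apply/mem_omega; exists n.
Qed.

Lemma ordadd_ord a b : is_ordinal a -> is_ordinal b -> is_ordinal (ordadd a b).
Proof.
move=> oa; elim/(well_founded_ind inV_wf): b => b IH ob.
have om y : y ∈ ordadd a b -> is_ordinal y.
  by move=> /mem_ordadd [/(ord_in oa)//|[c cb ->]]; apply: IH => //; exact: ord_in cb.
split=> y yab; last by have [] := om y yab.
move: yab => /mem_ordadd [ya|[c cb ->]] z.
  by move=> zy; apply/mem_ordadd; left; exact: ord_trans zy ya.
move=> /mem_ordadd [za|[d dc ->]]; apply/mem_ordadd; first by left.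
by right; exists d => //; exact: ord_trans dc cb.
Qed.

Lemma ordadd0 a : ordadd a emptyV = a.
Proof.
apply: V_ext => z; rewrite mem_ordadd; split=> [[//|[c /mem_emptyV//]]|]; by left.
Qed.

Lemma ordmul_ord a b : is_ordinal a -> is_ordinal b -> is_ordinal (ordmul a b).
Proof.
move=> oa; elim/(well_founded_ind inV_wf): b => b IH ob.
have oc c : c ∈ b -> is_ordinal (ordadd (ordmul a c) a).
  by move=> cb; apply: ordadd_ord => //; apply: IH => //; exact: ord_in cb.
split=> y /mem_ordmul [c cb yc]; last by have [] := ord_in (oc c cb) yc.
by move=> z zy; apply/mem_ordmul; exists c => //; exact: ord_trans (oc c cb) zy yc.
Qed.

(** By induction x ⊆ ω·x, so x is an element of ω·x or equal to ω·x + 0; either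
    way it lies in the block ω·x + ω. *)
Lemma sub_ordmul_omega a : is_ordinal a -> a ⊆ ordmul omega a.
Proof.
elim/(well_founded_ind inV_wf): a => a IH oa x xa.
have ox := ord_in oa xa.
apply/mem_ordmul; exists x => //; apply/mem_ordadd.
case: (ord_sub ox (ordmul_ord omega_ord ox) (IH x xa ox)); first by left.
move=> E; right; exists emptyV; last by rewrite ordadd0.
by apply/mem_omega; exists 0.
Qed.

Lemma omega1_ord : is_ordinal omega1.
Proof.
split=> y /mem_omega1 [oy [f fi]]; last by case: oy.
move=> z zy; apply/mem_omega1; split; first exact: ord_in zy.
by exists f => u v uz vz; apply: fi; exact: ord_trans zy.
Qed.

(** * Predicates definable over a transitive set *)

Fixpoint rename (r : nat -> nat) (phi : form) : form :=
  match phi with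
  | FMem i k => FMem (r i) (r k)
  | FEq i k => FEq (r i) (r k)
  | FNot p => FNot (rename r p)
  | FAnd p q => FAnd (rename r p) (rename r q)
  | FAll i p => FAll (r i) (rename r p)
  end.

Lemma sat_rename L r phi e : injective r ->
  sat L e (rename r phi) <-> sat L (fun n => e (r n)) phi.
Proof.
move=> r_inj; elim: phi e => //= [p IH|p IHp q IHq|i p IH] e.
- by rewrite IH.
- by rewrite IHp IHq.
- have E x : (fun n => if r n == r i then x else e (r n)) =
             (fun n => if n == i then x else e (r n)).
    by apply/funext => n; rewrite (inj_eq r_inj).
  by split=> H x /H; rewrite IH E.
Qed.

Fixpoint varbound (phi : form) : nat :=
  match phi with
  | FMem i k | FEq i k => (maxn i k).+1
  | FNot p => varbound p
  | FAnd p q => maxn (varbound p) (varbound q)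
  | FAll i p => maxn i.+1 (varbound p)
  end.

Lemma sat_local L phi e f : (forall n, n < varbound phi -> e n = f n) ->
  sat L e phi <-> sat L f phi.
Proof.
elim: phi e f => /= [i k|i k|p IH|p IHp q IHq|i p IH] e f ef.
- by rewrite !ef //; lia.
- by rewrite !ef //; lia.
- by rewrite (IH _ _ ef).
- by rewrite (IHp e f) 1?(IHq e f) // => n ?; apply: ef; lia.
- by split=> H x /H; apply IH => n ?; case: eqP => // _; rewrite ef //; lia.
Qed.

(** Elementarity is applied to predicates on sets instead of formulas: a
    predicate of an environment is definable if some formula expresses it.  The
    closure lemmas read the environment with de Bruijn indices, a quantifier
    binding index 0 and moving the other indices up by one. *)
Definition definable (L : V) (P : (nat -> V) -> Prop) : Prop :=
  exists phi, forall e, (forall n, e n ∈ L) -> (sat L e phi <-> P e).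

Section Definable.
Variable L : V.
Implicit Types P Q : (nat -> V) -> Prop.

Lemma definable_ext P Q :
  (forall e, (forall n, e n ∈ L) -> (P e <-> Q e)) ->
  definable L P -> definable L Q.
Proof. by move=> PQ [phi H]; exists phi => e eL; rewrite H // PQ. Qed.

Lemma definable_mem i k : definable L (fun e => e i ∈ e k).
Proof. by exists (FMem i k). Qed.

Lemma definable_eq i k : definable L (fun e => e i = e k).
Proof. by exists (FEq i k). Qed.

Lemma definable_not P : definable L P -> definable L (fun e => ~ P e).
Proof. by move=> [p H]; exists (FNot p) => e eL /=; rewrite H. Qed.

Lemma definable_and P Q :
  definable L P -> definable L Q -> definable L (fun e => P e /\ Q e).
Proof. by move=> [p H] [q K]; exists (FAnd p q) => e eL /=; rewrite H // K. Qed.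

Lemma definable_imp P Q :
  definable L P -> definable L Q -> definable L (fun e => P e -> Q e).
Proof.
move=> dP dQ; apply: definable_ext (definable_not (definable_and dP (definable_not dQ))).
by move=> e _; split=> [H p|H [p]]; [apply: contrapT => q; apply: H|apply; exact: H].
Qed.

Lemma definable_or P Q :
  definable L P -> definable L Q -> definable L (fun e => P e \/ Q e).
Proof.
move=> dP dQ; apply: definable_ext (definable_imp (definable_not dP) dQ) => e _.
split=> [H|[p /(_ p)//|q _ //]].
by have [p|/H q] := pselect (P e); [left|right].
Qed.

Lemma definable_iff P Q :
  definable L P -> definable L Q -> definable L (fun e => P e <-> Q e).
Proof.
by move=> dP dQ; apply: definable_and; apply: definable_imp.
Qed.

(** Formulas have named variables.  The bound variable 0 is renamed to a
    variable N beyond all those that occur, the variables 1, ..., N move down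
    by one, and then N is quantified; the renaming has to be injective on all
    of nat for satisfaction to be preserved. *)
Lemma definable_all (Q : (nat -> V) -> V -> Prop) :
  definable L (fun e => Q (fun n => e n.+1) (e 0)) ->
  definable L (fun e => forall x, x ∈ L -> Q e x).
Proof.
move=> [phi H]; pose N := varbound phi.
pose r n := if n is m.+1 then (if m < N then m else m.+1) else N.
have r_inj : injective r.
  by case=> [|m] [|n] //=; rewrite /r; case: ifP; try case: ifP; lia.
exists (FAll N (rename r phi)) => e eL /=.
suff E x : x ∈ L -> sat L (fun n => if n == N then x else e n) (rename r phi) <-> Q e x.
  by split=> K x xL; apply/E => //; exact: K.
move=> xL; rewrite sat_rename //.
rewrite (@sat_local _ _ _ (fun n => if n is m.+1 then e m else x)); last first.
  case=> [|n] nN; rewrite /= ?eqxx //; rewrite -/N in nN.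
  have -> : n < N by lia.
  by case: eqP => //; lia.
by rewrite H //; case.
Qed.

Lemma definable_ex (Q : (nat -> V) -> V -> Prop) :
  definable L (fun e => Q (fun n => e n.+1) (e 0)) ->
  definable L (fun e => exists2 x, x ∈ L & Q e x).
Proof.
move=> /definable_not dQ.
apply: definable_ext (definable_not (@definable_all (fun e x => ~ Q e x) dQ)) => e _.
split=> [H|[x xL q] /(_ x xL)//].
by apply: contrapT => K; apply: H => x xL q; apply: K; exists x.
Qed.

End Definable.

Ltac def1 :=
  match goal with
  | |- definable _ (fun e => e _ ∈ e _) => apply: definable_mem
  | |- definable _ (fun e => e _ = e _) => apply: definable_eq
  | |- definable _ (fun e => ~ _) => apply: definable_not
  | |- definable _ (fun e => _ /\ _) => apply: definable_and
  | |- definable _ (fun e => _ \/ _) => apply: definable_or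
  | |- definable _ (fun e => _ <-> _) => apply: definable_iff
  | |- definable _ (fun e => exists2 x, _ & _) => apply: definable_ex
  | |- definable ?L (fun e => forall x, x ∈ ?L -> _) => apply: definable_all
  | |- definable _ (fun e => _ -> _) => apply: definable_imp
  end.

Section DefinableSets.
Variable L : V.
Hypothesis Ltr : transitive_set L.

Lemma Lin x y : y ∈ x -> x ∈ L -> y ∈ L.
Proof. by move=> yx xL; exact: Ltr xL _ yx. Qed.

Lemma ext_L x y : x ∈ L -> y ∈ L -> (forall z, z ∈ L -> (z ∈ x <-> z ∈ y)) -> x = y.
Proof. by move=> xL yL H; apply: V_ext => z; split=> zx; apply/H => //; exact: Lin zx _. Qed.

Lemma definable_sub i k : definable L (fun e => e i ⊆ e k).
Proof.
apply: (@definable_ext _ (fun e => forall z, z ∈ L -> z ∈ e i -> z ∈ e k)).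
  move=> e eL; split=> H z; last by move=> _; exact: H.
  by move=> zi; apply: H => //; exact: Lin zi _.
by repeat def1.
Qed.

Lemma definable_transitive i : definable L (fun e => transitive_set (e i)).
Proof.
apply: (@definable_ext _ (fun e => forall z, z ∈ L -> z ∈ e i -> z ⊆ e i)).
  move=> e eL; split=> H z; last by move=> _; exact: H.
  by move=> zi; apply: H => //; exact: Lin zi _.
by repeat def1; apply: definable_sub.
Qed.

Lemma definable_ordinal i : definable L (fun e => is_ordinal (e i)).
Proof.
apply: definable_and; first exact: definable_transitive.
apply: (@definable_ext _ (fun e => forall z, z ∈ L -> z ∈ e i -> transitive_set z)).
  move=> e eL; split=> H z; last by move=> _; exact: H.
  by move=> zi; apply: H => //; exact: Lin zi _.
by repeat def1; apply: definable_transitive.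
Qed.

Definition capV (x y : V) : V := setof (fun z => z ∈ x /\ z ∈ y).

Lemma mem_capV x y z : z ∈ capV x y <-> z ∈ x /\ z ∈ y.
Proof. by apply: (@separation x) => w []. Qed.

Hypothesis Lsub : forall x y, x ∈ L -> y ⊆ x -> y ∈ L.

Lemma capV_L x y : x ∈ L -> capV x y ∈ L.
Proof. by move=> xL; apply: Lsub xL _ => z /mem_capV []. Qed.

Lemma definable_cap i k l : definable L (fun e => e i = capV (e k) (e l)).
Proof.
apply: (@definable_ext _ (fun e => forall z, z ∈ L -> z ∈ e i <-> z ∈ e k /\ z ∈ e l)).
  move=> e eL; split=> [H|-> z _]; last exact: mem_capV.
  by apply: ext_L => [||z zL]; [|exact: capV_L|rewrite mem_capV; exact: H].
by repeat def1.
Qed.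

Hypothesis Lupair : forall x y, x ∈ L -> y ∈ L -> upair x y ∈ L.

Lemma opair_L x y : x ∈ L -> y ∈ L -> opair x y ∈ L.
Proof. by move=> xL yL; apply: (Lupair); apply: Lupair. Qed.

Lemma definable_upair i k l : definable L (fun e => e i = upair (e k) (e l)).
Proof.
apply: (@definable_ext _ (fun e => forall z, z ∈ L -> z ∈ e i <-> z = e k \/ z = e l)).
  move=> e eL; split=> [H|-> z _]; last exact: mem_upair.
  by apply: ext_L => [||z zL]; [|exact: Lupair|rewrite mem_upair; exact: H].
by repeat def1.
Qed.

Lemma definable_opair i k l : definable L (fun e => e i = opair (e k) (e l)).
Proof.
apply: (@definable_ext _ (fun e => exists2 u, u ∈ L & exists2 v, v ∈ L &
    (u = upair (e k) (e k) /\ v = upair (e k) (e l)) /\ e i = upair u v)).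
  move=> e eL; split=> [[u _ [v _ [[-> ->]]]]//|->].
  exists (upair (e k) (e k)); first exact: Lupair.
  by exists (upair (e k) (e l)) => //; exact: Lupair.
by repeat def1; apply: definable_upair.
Qed.

Lemma definable_opair_mem i k l : definable L (fun e => opair (e i) (e k) ∈ e l).
Proof.
apply: (@definable_ext _ (fun e => exists2 p, p ∈ L & p = opair (e i) (e k) /\ p ∈ e l)).
  move=> e eL; split=> [[p _ [->]]//|H].
  by exists (opair (e i) (e k)) => //; exact: opair_L.
by repeat def1; apply: definable_opair.
Qed.

Hypothesis LVset : forall x, x ∈ L -> Vset x ∈ L.

(** The elements of such an [f] that are pairs (b, w) have w = V_b, and they
    are closed downwards in b.  This makes the recursion that defines the
    hierarchy expressible by quantifying over sets. *)
Definition Vset_attempt (f : V) : Prop :=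
  forall b, b ∈ L -> forall w, w ∈ L -> opair b w ∈ f ->
    (forall c, c ∈ L -> c ∈ b -> exists2 u, u ∈ L & opair c u ∈ f) /\
    (forall z, z ∈ L -> z ∈ w <-> exists2 c, c ∈ L & c ∈ b /\
        exists2 u, u ∈ L & opair c u ∈ f /\ z ⊆ u).

Lemma Vset_attemptP f b w : Vset_attempt f -> b ∈ L -> w ∈ L ->
  opair b w ∈ f -> w = Vset b.
Proof.
move=> Hf; elim/(well_founded_ind inV_wf): b w => b IH w bL wL bw.
have [dom mem] := Hf b bL w wL bw.
apply: ext_L => //; first exact: LVset.
move=> z zL; rewrite mem // mem_Vset; split.
  move=> [c cL [cb [u uL [cu zu]]]]; exists c => //.
  by rewrite -(IH c cb u).
move=> [c cb zc]; have cL := Lin cb bL; exists c => //; split=> //.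
have [u uL cu] := dom c cL cb; exists u => //; split=> //.
by rewrite (IH c cb u).
Qed.

Lemma Vset_attempt_ex x : x ∈ L ->
  exists f, [/\ f ∈ L, Vset_attempt f & opair x (Vset x) ∈ f].
Proof.
move=> xL; pose d := Vset (sing x); pose w := Vset (sing (sing (sing x))).
(* the hierarchy up to the rank of x, as a set of pairs *)
pose f := setof (fun p => p ∈ w /\ exists2 c, c ∈ d & p = opair c (Vset c)).
have fE p : p ∈ f <-> p ∈ w /\ exists2 c, c ∈ d & p = opair c (Vset c).
  by apply: (@separation w) => q [].
have xs z : z ∈ sing z by apply/mem_sing.
have df c : c ∈ d -> opair c (Vset c) ∈ f.
  move=> cd; apply/fE; split; last by exists c.
  apply: opair_Vset => //; apply/mem_Vset; exists x => //; apply: Vset_mono.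
  by move: cd => /mem_Vset [y /mem_sing ->].
have sL z : z ∈ L -> sing z ∈ L by move=> zL; apply: Lupair.
exists f; split.
- apply: (@Lsub w); last by move=> p /fE [].
  exact: LVset (sL _ (sL _ (sL _ xL))).
- move=> b bL u uL /fE [_ [c cd /opair_inj [cb ub]]]; subst b u; split.
    move=> b bL' bc; exists (Vset b); first exact: LVset.
    by apply: df; exact: Vset_trans cd _ bc.
  move=> z zL; rewrite mem_Vset; split.
    move=> [b bc zb]; exists b; first exact: Lin bc bL.
    split=> //; exists (Vset b); first by apply: LVset; exact: Lin bc bL.
    by split=> //; apply: df; exact: Vset_trans cd _ bc.
  move=> [b bL' [bc [u _ [/fE [_ [b' _ /opair_inj [bb ub]]] zu]]]]; subst b' u.
  by exists b.
- by apply: df; apply: Vset_self.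
Qed.

Lemma definable_Vset i k : definable L (fun e => e i = Vset (e k)).
Proof.
apply: (@definable_ext _ (fun e => exists2 f, f ∈ L &
    Vset_attempt f /\ opair (e k) (e i) ∈ f)).
  move=> e eL; split=> [[f fL [Hf]]|->].
    exact: Vset_attemptP.
  by have [f [fL Hf fx]] := Vset_attempt_ex (eL k); exists f.
rewrite /Vset_attempt.
by repeat first [apply: definable_opair_mem | apply: definable_sub | def1].
Qed.

End DefinableSets.

(** * Elementary maps and pieces of their graphs *)

(** Elementarity for predicates of at most three arguments, which is all that
    the finite-support description consumes.  The three arguments allow the
    binary operations on sets to be treated as relations. *)
Definition elementary3 (L : V) (k : V -> V) : Prop :=
  (forall x, x ∈ L -> k x ∈ L) /\
  forall P : V -> V -> V -> Prop,
    definable L (fun e => P (e 0) (e 1) (e 2)) ->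
    forall x y z, x ∈ L -> y ∈ L -> z ∈ L -> (P x y z <-> P (k x) (k y) (k z)).

Lemma app_fun f M N x : is_fun f M N -> x ∈ M -> opair x (app f x) ∈ f /\ app f x ∈ N.
Proof.
move=> [fp ff] /ff [y [xy _]].
have H : opair x (app f x) ∈ f.
  by apply: (@theP (fun y => opair x y ∈ f)); exists y.
split=> //; have [u [v [_ vN E]]] := fp _ H.
by have [_ ->] := opair_inj E.
Qed.

Lemma app_unique f M N x y : is_fun f M N -> opair x y ∈ f -> app f x = y.
Proof.
move=> ff xy; have [u [v [uM _ /opair_inj [xu _]]]] := proj1 ff _ xy; subst u.
have [H _] := app_fun ff uM; have [w [_ wu]] := proj2 ff _ uM.
by rewrite -(wu _ H) -(wu _ xy).
Qed.

Lemma elementary_definable f L P e : elementary f L L -> definable L P ->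
  (forall n, e n ∈ L) -> (P e <-> P (fun n => app f (e n))).
Proof.
move=> [ff fe] [phi H] eL; rewrite -H // -H; first exact: fe.
by move=> n; have [] := app_fun ff (eL n).
Qed.

Lemma elementary_elementary3 f L : elementary f L L -> elementary3 L (app f).
Proof.
move=> ef; split=> [x xL|P dP x y z xL yL zL]; first by have [] := app_fun (proj1 ef) xL.
apply: (@elementary_definable f L _ (fun n => nth z [:: x; y] n) ef dP).
by do 3?case.
Qed.

Section Elem3.
Variables (L : V) (k : V -> V).
Hypothesis Ltr : transitive_set L.
Hypothesis Lsub : forall x y, x ∈ L -> y ⊆ x -> y ∈ L.
Hypothesis Lupair : forall x y, x ∈ L -> y ∈ L -> upair x y ∈ L.
Hypothesis LVset : forall x, x ∈ L -> Vset x ∈ L.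
Hypothesis ke : elementary3 L k.

Lemma elementary3_pred1 (P : V -> Prop) x : definable L (fun e => P (e 0)) ->
  x ∈ L -> (P x <-> P (k x)).
Proof. by move=> dP xL; exact: (proj2 ke (fun x _ _ => P x) dP x x x). Qed.

Lemma elementary3_pred2 (P : V -> V -> Prop) x y :
  definable L (fun e => P (e 0) (e 1)) ->
  x ∈ L -> y ∈ L -> (P x y <-> P (k x) (k y)).
Proof. by move=> dP xL yL; exact: (proj2 ke (fun x y _ => P x y) dP x y y). Qed.

Lemma elementary3_mem x y : x ∈ L -> y ∈ L -> (x ∈ y <-> k x ∈ k y).
Proof.
by move=> xL yL; apply: (proj2 ke (fun x y _ => x ∈ y) (definable_mem _ 0 1) x y y).
Qed.

Lemma elementary3_inj x y : x ∈ L -> y ∈ L -> (x = y <-> k x = k y).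
Proof.
by move=> xL yL; apply: (proj2 ke (fun x y _ => x = y) (definable_eq _ 0 1) x y y).
Qed.

Lemma elementary3_sub x y : x ∈ L -> y ∈ L -> (x ⊆ y <-> k x ⊆ k y).
Proof.
move=> xL yL.
by apply: (proj2 ke (fun x y _ => x ⊆ y) _ x y y xL yL yL); apply: definable_sub.
Qed.

Lemma elementary3_ord x : x ∈ L -> (is_ordinal x <-> is_ordinal (k x)).
Proof.
move=> xL.
by apply: (proj2 ke (fun x _ _ => is_ordinal x) _ x x x xL xL xL); apply: definable_ordinal.
Qed.

Lemma elementary3_cap x y : x ∈ L -> y ∈ L -> k (capV x y) = capV (k x) (k y).
Proof.
move=> xL yL.
by apply: (proj1 (proj2 ke (fun x y z => z = capV x y) _ x y _ xL yL _)) => //;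
  [exact: definable_cap|exact: capV_L].
Qed.

Lemma elementary3_upair x y : x ∈ L -> y ∈ L -> k (upair x y) = upair (k x) (k y).
Proof.
move=> xL yL.
by apply: (proj1 (proj2 ke (fun x y z => z = upair x y) _ x y _ xL yL _)) => //;
  [exact: definable_upair|exact: Lupair].
Qed.

Lemma elementary3_opair x y : x ∈ L -> y ∈ L -> k (opair x y) = opair (k x) (k y).
Proof. by move=> xL yL; rewrite /opair !elementary3_upair //; apply: Lupair. Qed.

Lemma elementary3_Vset x : x ∈ L -> k (Vset x) = Vset (k x).
Proof.
move=> xL.
by apply: (proj1 (proj2 ke (fun x y _ => y = Vset x) _ x _ x xL _ xL)) => //;
  [exact: definable_Vset|exact: LVset].
Qed.

Lemma elementary3_L x : x ∈ L -> k x ∈ L.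
Proof. exact: (proj1 ke). Qed.

(** An elementary map does not lower ranks: by induction, the elements of [x]
    go to elements of [k x] of no smaller rank. *)
Lemma Vset_elementary3 x : x ∈ L -> Vset x ⊆ Vset (k x).
Proof.
elim/(well_founded_ind inV_wf): x => x IH xL z /mem_Vset [b bx zb].
have bL := Lin Ltr bx xL.
apply/mem_Vset; exists (k b); first exact/(elementary3_mem bL xL).
by move=> w /zb; exact: IH.
Qed.

Lemma elementary3_cofinal x : x ∈ L -> x ∈ Vset (k (sing x)).
Proof.
move=> xL; apply: Vset_elementary3; first exact: Lupair.
by apply: Vset_self; apply/mem_sing.
Qed.

(** These pieces are how a map on [L], which is not an element of [L], becomes
    accessible to another embedding. *)
Definition graph_below (y : V) : V :=
  setof (fun p => p ∈ Vset y /\ exists2 x, x ∈ L & p = opair x (k x)).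

Lemma mem_graph_below y p :
  p ∈ graph_below y <-> p ∈ Vset y /\ exists2 x, x ∈ L & p = opair x (k x).
Proof. by apply: (@separation (Vset y)) => q []. Qed.

Lemma graph_below_L y : y ∈ L -> graph_below y ∈ L.
Proof. by move=> yL; apply: (Lsub (LVset yL)) => p /mem_graph_below []. Qed.

Lemma graph_below_cap y y' : Vset y ⊆ Vset y' ->
  graph_below y = capV (graph_below y') (Vset y).
Proof.
move=> yy'; apply: V_ext => p; rewrite mem_capV !mem_graph_below; split.
  by move=> [py H]; split; [split=> //; exact: yy'|].
by move=> [[_ H] py].
Qed.

(** A level high enough for the pairs (x, k x) with x in [Vset a]: both
    coordinates lie in the level of {a, k a}, and forming an ordered pair costs
    two more levels. *)
Definition graph_bound (a : V) : V := sing (sing (upair a (k a))).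

Lemma graph_bound_L a : a ∈ L -> graph_bound a ∈ L.
Proof.
move=> aL; have s z : z ∈ L -> sing z ∈ L by move=> zL; exact: Lupair.
by do 2!apply: (s _); exact: (Lupair aL (elementary3_L aL)). Qed.

Lemma graph_boundP a x : a ∈ L -> x ∈ Vset a ->
  opair x (k x) ∈ graph_below (graph_bound a).
Proof.
move=> aL xa; have xL := Lin Ltr xa (LVset aL).
apply/mem_graph_below; split; last by exists x.
apply: opair_Vset.
  by apply: (Vset_in_sub _ xa); apply/mem_upair; left.
apply: (@Vset_in_sub _ (k a)); first by apply/mem_upair; right.
by rewrite -elementary3_Vset //; apply/(elementary3_mem xL (LVset aL)).
Qed.

End Elem3.

(** * Applying the embedding to other embeddings *)

Section Star.
Variables (L j : V).
Hypothesis Ltr : transitive_set L.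
Hypothesis Lsub : forall x y, x ∈ L -> y ⊆ x -> y ∈ L.
Hypothesis Lupair : forall x y, x ∈ L -> y ∈ L -> upair x y ∈ L.
Hypothesis LVset : forall x, x ∈ L -> Vset x ∈ L.
Hypothesis ej : elementary j L L.
Let jj := app j.
Let je : elementary3 L jj := elementary_elementary3 ej.
Local Notation gr := (graph_below L).

(** The value at [x] of j⁺(k), read off from the images of the pieces of the
    graph of [k]. *)
Definition star (k : V -> V) (x : V) : V :=
  the (fun y => exists2 v, v ∈ L & opair x y ∈ jj (gr k v)).

Section One.
Variable k : V -> V.
Hypothesis ke : elementary3 L k.

Let grL y : y ∈ L -> gr k y ∈ L. Proof. exact: graph_below_L. Qed.

Let jgr_mono y y' : y ∈ L -> y' ∈ L -> Vset y ⊆ Vset y' ->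
  jj (gr k y) = capV (jj (gr k y')) (Vset (jj y)).
Proof.
move=> yL y'L yy'; rewrite (graph_below_cap _ _ yy').
by rewrite (elementary3_cap _ _ je) ?(elementary3_Vset _ _ _ _ je) //;
  [exact: grL|exact: LVset].
Qed.

Let jgr_directed y y' p : y ∈ L -> y' ∈ L -> p ∈ jj (gr k y) ->
  p ∈ jj (gr k (upair y y')).
Proof.
move=> yL y'L; rewrite (@jgr_mono y (upair y y')) //; last 2 first.
- exact: Lupair.
- by apply: Vset_in_sub; apply/mem_upair; left.
by move=> /mem_capV [].
Qed.

(** The heart of the matter: that [k] preserves the predicate [P] at arguments
    in a fixed level is a statement about one piece of its graph, and [j]
    carries it to the image of the piece. *)
Let jgr_transfer (P : V -> V -> V -> Prop) :
  definable L (fun e => P (e 0) (e 1) (e 2)) ->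
  forall v, v ∈ L ->
  forall x y z, x ∈ L -> y ∈ L -> z ∈ L ->
  forall x' y' z', x' ∈ L -> y' ∈ L -> z' ∈ L ->
    opair x x' ∈ jj (gr k v) -> opair y y' ∈ jj (gr k v) ->
    opair z z' ∈ jj (gr k v) -> (P x y z <-> P x' y' z').
Proof.
move=> dP v vL.
pose Q f := forall x, x ∈ L -> forall y, y ∈ L -> forall z, z ∈ L ->
  forall x', x' ∈ L -> forall y', y' ∈ L -> forall z', z' ∈ L ->
  opair x x' ∈ f -> opair y y' ∈ f -> opair z z' ∈ f -> (P x y z <-> P x' y' z').
have dPs a b c : definable L (fun e => P (e a) (e b) (e c)).
  (* [P] is tested at arbitrary indices by quantifying over copies of them,
     listed so that they occupy the indices 0, 1 and 2 *)
  apply: (@definable_ext _ (fun e => exists2 w, w ∈ L & exists2 v, v ∈ L &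
    exists2 u, u ∈ L & ((u = e a /\ v = e b) /\ w = e c) /\ P u v w)).
    move=> e eL; split=> [[w _ [u _ [t _ [[[-> ->] ->]]]]]//|H].
    by exists (e c) => //; exists (e b) => //; exists (e a).
  by repeat first [exact: dP | def1].
have dQ : definable L (fun e => Q (e 0)).
  rewrite /Q; repeat first [exact: dPs | apply: definable_opair_mem => // | def1].
have : Q (jj (gr k v)).
  apply/(elementary3_pred1 je dQ (grL vL)).
  move=> x xL y yL z zL x' _ y' _ z' _.
  move=> /mem_graph_below [_ [? ? /opair_inj [<- ->]]].
  move=> /mem_graph_below [_ [? ? /opair_inj [<- ->]]].
  move=> /mem_graph_below [_ [? ? /opair_inj [<- ->]]].
  exact: (proj2 ke P dP).
by move=> H x y z xL yL zL x' y' z' x'L y'L z'L; exact: H.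
Qed.

Let jgr_pairs v p : v ∈ L -> p ∈ jj (gr k v) ->
  exists x y, [/\ x ∈ L, y ∈ L & p = opair x y].
Proof.
move=> vL; pose Q f := forall p, p ∈ L -> p ∈ f ->
  exists2 x, x ∈ L & exists2 y, y ∈ L & p = opair x y.
have dQ : definable L (fun e => Q (e 0)).
  by rewrite /Q; repeat first [apply: definable_opair => // | def1].
have HQ : Q (jj (gr k v)).
  apply/(elementary3_pred1 je dQ (grL vL)).
  move=> q _ /mem_graph_below [_ [x xL ->]].
  by exists x => //; exists (k x) => //; exact: (elementary3_L ke).
move=> pv; have [|x xL [y yL pE]] := HQ p _ pv; last by exists x, y.
by apply: (Lin Ltr pv); apply: (elementary3_L je); exact: grL.
Qed.

Let jgr_unique v v' x y y' : v ∈ L -> v' ∈ L -> x ∈ L ->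
  opair x y ∈ jj (gr k v) -> opair x y' ∈ jj (gr k v') -> y = y'.
Proof.
move=> vL v'L xL xy xy'.
have wL : upair v v' ∈ L by exact: Lupair.
have h : opair x y ∈ jj (gr k (upair v v')) by exact: jgr_directed.
have h' : opair x y' ∈ jj (gr k (upair v v')).
  have -> : upair v v' = upair v' v.
    by apply: V_ext => z; rewrite !mem_upair; tauto.
  exact: jgr_directed.
have [x1 [y1 [_ y1L /opair_inj [_ yE]]]] := jgr_pairs wL h; subst y1.
have [x2 [y2 [_ y2L /opair_inj [_ yE]]]] := jgr_pairs wL h'; subst y2.
apply/(jgr_transfer (P := fun x y _ => x = y) _ wL xL xL xL y1L y2L y1L) => //.
exact: definable_eq.
Qed.

Let jgr_total x : x ∈ L -> exists v y, [/\ v ∈ L, y ∈ L & opair x y ∈ jj (gr k v)].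
Proof.
move=> xL; pose a := sing x; pose v := graph_bound k a.
have aL : a ∈ L by exact: Lupair.
have vL : v ∈ L by exact: graph_bound_L.
pose Q d f := forall u, u ∈ L -> u ∈ d -> exists2 w, w ∈ L & opair u w ∈ f.
have dQ : definable L (fun e => Q (e 0) (e 1)).
  by rewrite /Q; repeat first [apply: definable_opair_mem => // | def1].
have : Q (jj (Vset a)) (jj (gr k v)).
  apply/(elementary3_pred2 je dQ (LVset aL) (grL vL)).
  move=> u uL ua; exists (k u); first exact: (elementary3_L ke).
  exact: graph_boundP.
move=> /(_ x xL) []; last by move=> y yL xy; exists v, y.
by rewrite (elementary3_Vset _ _ _ _ je) //; exact: (elementary3_cofinal Ltr Lupair je xL).
Qed.

Lemma starP x : x ∈ L -> star k x ∈ L /\ exists2 v, v ∈ L & opair x (star k x) ∈ jj (gr k v).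
Proof.
move=> xL; have [v [y [vL yL xy]]] := jgr_total xL.
have [w wL xw] : exists2 v, v ∈ L & opair x (star k x) ∈ jj (gr k v).
  by apply: (@theP (fun y => exists2 v, v ∈ L & opair x y ∈ jj (gr k v))); exists y, v.
by split; [rewrite -(jgr_unique vL wL xL xy xw)|exists w].
Qed.

Lemma star_unique v x y : v ∈ L -> opair x y ∈ jj (gr k v) -> y = star k x.
Proof.
move=> vL xy; have [x1 [y1 [xL _ /opair_inj [xE _]]]] := jgr_pairs vL xy; subst x1.
by have [_ [w wL xw]] := starP xL; exact: jgr_unique vL wL xL xy xw.
Qed.

Lemma star_elementary3 : elementary3 L (star k).
Proof.
split=> [x xL|P dP x y z xL yL zL]; first by have [] := starP xL.
have [x'L [u uL hx]] := starP xL; have [y'L [v vL hy]] := starP yL.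
have [z'L [w wL hz]] := starP zL.
have uvL : upair u v ∈ L by exact: Lupair.
have tL : upair w (upair u v) ∈ L by exact: Lupair.
have upC a b : upair a b = upair b a.
  by apply: V_ext => c; rewrite !mem_upair; tauto.
apply: (jgr_transfer dP tL) => //; last exact: jgr_directed.
  by rewrite upC; apply: jgr_directed => //; exact: jgr_directed.
by rewrite upC; apply: jgr_directed => //; rewrite upC; exact: jgr_directed.
Qed.

(** The pair (x, k x) belongs to a piece of the graph of [k], so its image
    belongs to the graph of j⁺(k). *)
Lemma star_app x : x ∈ L -> jj (k x) = star k (jj x).
Proof.
move=> xL; have sL : sing x ∈ L by exact: Lupair.
have kL := elementary3_L ke xL.
have bL := graph_bound_L Lupair ke sL.
apply: (star_unique bL); rewrite -(elementary3_opair _ _ je) //.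
apply/(elementary3_mem je (opair_L Lupair xL kL) (grL bL)).
by apply: graph_boundP => //; apply: Vset_self; apply/mem_sing.
Qed.

Lemma star_graph y : y ∈ L -> jj (gr k y) = gr (star k) (jj y).
Proof.
move=> yL; apply: V_ext => p; rewrite mem_graph_below; split=> [py|].
  split.
    rewrite -(elementary3_Vset _ _ _ _ je) //.
    suff : jj (gr k y) ⊆ jj (Vset y) by apply.
    apply/(elementary3_sub Ltr je (grL yL) (LVset yL)).
    by move=> q /mem_graph_below [].
  have [x [w [xL wL pE]]] := jgr_pairs yL py; exists x => //; subst p.
  by rewrite (star_unique yL py).
move=> [py [x xL pE]]; have [_ [v vL xv]] := starP xL.
rewrite (@jgr_mono y (upair v y)) ?mem_capV //.
- by split=> //; rewrite pE; exact: jgr_directed.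
- exact: Lupair.
- by apply: Vset_in_sub; apply/mem_upair; right.
Qed.

End One.

(** [iterate n] is the embedding J_n of the finite stages; applying [j] each
    time agrees with applying J_n to itself, by [iterate_graph] for m = l. *)
Fixpoint iterate (n : nat) : V -> V :=
  if n is m.+1 then star (iterate m) else jj.

Lemma iterate_elementary3 n : elementary3 L (iterate n).
Proof. by elim: n => [|n IH] //=; exact: star_elementary3. Qed.

(** That J_m⁺(J_l) = J_(l+1) for m <= l.  For m = 0 this is the definition.  For
    m + 1 and l + 1 it is the image under [j] of the equation for m and l,
    which gives it at levels in the range of [j]; these are cofinal, and
    intersecting with [Vset y] gives it at all levels. *)
Lemma iterate_graph m l y : m <= l -> y ∈ L ->
  iterate m (gr (iterate l) y) = gr (iterate l.+1) (iterate m y).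
Proof.
elim: m l y => [|m IH] l y ml yL; first by apply: star_graph => //; exact: iterate_elementary3.
case: l ml => // l ml; have ml' : m <= l by [].
have em := iterate_elementary3 m; have em1 := iterate_elementary3 m.+1.
have el := iterate_elementary3 l; have el1 := iterate_elementary3 l.+1.
have el2 := iterate_elementary3 l.+2.
have jyL : jj y ∈ L by exact: (elementary3_L je).
have yjy : Vset y ⊆ Vset (jj y) by exact: (Vset_elementary3 Ltr je).
have key : iterate m.+1 (gr (iterate l.+1) (jj y)) =
           gr (iterate l.+2) (iterate m.+1 (jj y)).
  have -> : iterate l.+1 = star (iterate l) by [].
  rewrite -star_graph // -/(iterate l.+1).
  have -> : iterate m.+1 = star (iterate m) by [].
  rewrite -!star_app //; last exact: graph_below_L.
  by rewrite IH // star_graph //; exact: elementary3_L.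
(* from the level jj y in the range of jj back to the level y *)
rewrite (graph_below_cap _ _ yjy) (elementary3_cap _ _ em1) //; last 2 first.
- exact: graph_below_L.
- exact: LVset.
rewrite key (elementary3_Vset _ _ _ _ em1) // -graph_below_cap //.
rewrite -!(elementary3_Vset _ _ _ _ em1) //.
by apply/(elementary3_sub Ltr em1 (LVset yL) (LVset jyL)).
Qed.

(** [iterate_graph] evaluated at the pair (x, J_l x). *)
Lemma iterate_comm m l x : m <= l -> x ∈ L ->
  iterate m (iterate l x) = iterate l.+1 (iterate m x).
Proof.
move=> ml xL; have em := iterate_elementary3 m; have el := iterate_elementary3 l.
have lxL := elementary3_L el xL.
have sL : sing x ∈ L by exact: Lupair.
have bL := graph_bound_L Lupair el sL.
have : opair x (iterate l x) ∈ gr (iterate l) (graph_bound (iterate l) (sing x)).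
  by apply: graph_boundP => //; apply: Vset_self; apply/mem_sing.
move=> /(elementary3_mem em (opair_L Lupair xL lxL)
          (graph_below_L _ Lsub LVset bL)).
rewrite iterate_graph // (elementary3_opair _ _ em) // => /mem_graph_below [_ [z zL]].
by move=> /opair_inj [<- ->].
Qed.

End Star.

(** Supports are duplicate-free lists of sets, which needs an equality test. *)
HB.instance Definition _ := gen_eqMixin V.

(** * Closure properties of the base model *)

Section Rank.
Variables lam j : V.
Hypothesis hj : I3_embedding lam j.
Let L := Vset lam.
Let ej : elementary j L L. Proof. by case: hj. Qed.

Lemma crit_lt_image k : is_crt j lam k -> k ∈ app j k.
Proof.
move=> [ok kL kk fixk]; have je := elementary_elementary3 ej.
have ojk : is_ordinal (app j k) by apply/(elementary3_ord (@Vset_trans lam) je kL).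
have [x xk|//|E] := ord_sub ok ojk; last by case: kk.
have xL : x ∈ L := Lin (@Vset_trans lam) xk kL.
by rewrite -(fixk x xk); apply/(elementary3_mem je xL kL).
Qed.

(** The critical sequence is strictly increasing: κ_0 < j(κ_0), and
    elementarity propagates this along the sequence. *)
Lemma rank_limit x : x ∈ lam -> exists2 y, y ∈ lam & x ∈ y.
Proof.
have [_ _ [k kc lamE]] := hj; have je := elementary_elementary3 ej.
have kL n : iter n (app j) k ∈ L.
  by elim: n => [|n IH] /=; [case: kc|exact: (elementary3_L je)].
have kS n : iter n (app j) k ∈ iter n.+1 (app j) k.
  elim: n => [|n IH]; first exact: crit_lt_image.
  exact/(elementary3_mem je (kL n) (kL n.+1)).
move=> /lamE [n xn]; exists (iter n (app j) k) => //.
by apply/lamE; exists n.+1.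
Qed.

Let lam_ord : is_ordinal lam. Proof. by case: hj. Qed.

Lemma VlamP x : x ∈ L <-> exists2 a, a ∈ lam & x ∈ Vset a.
Proof.
split=> [/mem_Vset [b blam xb]|[a alam]]; last exact: Vset_in_sub.
have [c clam bc] := rank_limit blam.
by exists c => //; apply/mem_Vset; exists b.
Qed.

Lemma Vlam_upair x y : x ∈ L -> y ∈ L -> upair x y ∈ L.
Proof.
move=> /VlamP [a al xa] /VlamP [b bl yb].
have [c [cl ac bc]] : exists c, [/\ c ∈ lam, Vset a ⊆ Vset c & Vset b ⊆ Vset c].
  have oa := ord_in lam_ord al; have ob := ord_in lam_ord bl.
  case: (ord_trichotomy oa ob) => [ab|ab|ba].
  - by exists b; split=> //; exact: Vset_in_sub.
  - by exists b; split=> //; rewrite ab.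
  - by exists a; split=> //; exact: Vset_in_sub.
apply/mem_Vset; exists c => // z /mem_upair [->|->]; by [exact: ac|exact: bc].
Qed.

Lemma Vlam_cofinal x : x ∈ L -> exists a, [/\ a ∈ L, is_ordinal a & x ∈ Vset a].
Proof.
move=> /VlamP [a al xa]; exists a; split=> //; last exact: ord_in lam_ord al.
exact: Vset_self.
Qed.

Lemma Vlam_Vset x : x ∈ L -> Vset x ∈ L.
Proof.
by move=> /mem_Vset [b bl xb]; apply/mem_Vset; exists b => //; exact: Vset_mono.
Qed.

End Rank.

(** * Inserting elements into finite sets of ordinals *)

Section Support.
Variables lam j : V.
Hypothesis hj : I3_embedding lam j.
Let L := Vset lam.

Let Ltr : transitive_set L. Proof. exact: Vset_trans. Qed.
Let Lsub x y : x ∈ L -> y ⊆ x -> y ∈ L. Proof. exact: Vset_sub. Qed.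
Let Lup x y : x ∈ L -> y ∈ L -> upair x y ∈ L. Proof. exact: Vlam_upair hj _ _. Qed.
Let LVs x : x ∈ L -> Vset x ∈ L. Proof. exact: Vlam_Vset. Qed.
Let ej : elementary j L L. Proof. by case: hj. Qed.

Definition emb_iter (n : nat) : V -> V := iterate L j n.
Local Notation J := emb_iter.
Local Notation gr l y := (graph_below L (J l) y).

Let Je n : elementary3 L (J n). Proof. exact: iterate_elementary3. Qed.

Lemma J0 : J 0 = app j. Proof. by []. Qed.
Lemma J_L n x : x ∈ L -> J n x ∈ L. Proof. exact: (elementary3_L (Je n)). Qed.
Lemma J_mem n x y : x ∈ L -> y ∈ L -> x ∈ y <-> J n x ∈ J n y.
Proof. exact: (elementary3_mem (Je n)). Qed.
Lemma J_eq n x y : x ∈ L -> y ∈ L -> x = y <-> J n x = J n y.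
Proof. exact: (elementary3_inj (Je n)). Qed.
Lemma J_upair n x y : x ∈ L -> y ∈ L -> J n (upair x y) = upair (J n x) (J n y).
Proof. exact: (elementary3_upair Ltr Lup (Je n)). Qed.
Lemma J_Vset n x : x ∈ L -> J n (Vset x) = Vset (J n x).
Proof. exact: (elementary3_Vset Ltr Lsub Lup LVs (Je n)). Qed.
Lemma J_sub n x y : x ∈ L -> y ∈ L -> x ⊆ y <-> J n x ⊆ J n y.
Proof. exact: (elementary3_sub Ltr (Je n)). Qed.
Lemma J_ord n x : x ∈ L -> is_ordinal x -> is_ordinal (J n x).
Proof. by move=> xL ox; apply/(elementary3_ord Ltr (Je n) xL). Qed.
Lemma J_grow n x : x ∈ L -> Vset x ⊆ Vset (J n x).
Proof. exact: (Vset_elementary3 Ltr (Je n)). Qed.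
Lemma J_graph m l y : m <= l -> y ∈ L -> J m (gr l y) = gr l.+1 (J m y).
Proof. exact: iterate_graph. Qed.
Lemma J_comm m l x : m <= l -> x ∈ L -> J m (J l x) = J l.+1 (J m x).
Proof. exact: iterate_comm. Qed.
Lemma gr_L l y : y ∈ L -> gr l y ∈ L.
Proof. exact: graph_below_L. Qed.

Definition position (E : seq V) (e : V) : nat := count (fun x => `[< x ∈ e >]) E.

(** The map of [L] that corresponds to the inclusion of the finite set [E] in
    [E ++ s], the elements of [s] being inserted one after the other. *)
Fixpoint act (E s : seq V) (x : V) : V :=
  if s is e :: s' then act (rcons E e) s' (J (position E e) x) else x.

Definition ords (E : seq V) : Prop := forall e, e \in E -> is_ordinal e.

Lemma ords_cat E F : ords (E ++ F) <-> ords E /\ ords F.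
Proof.
split=> [H|[HE HF] e]; last by rewrite mem_cat => /orP [/HE|/HF].
by split=> e eE; apply: H; rewrite mem_cat eE ?orbT.
Qed.

Lemma position_perm E F e : perm_eq E F -> position E e = position F e.
Proof. by move=> /permP; exact. Qed.

Lemma position_rcons E e f :
  position (rcons E e) f = position E f + `[< e ∈ f >].
Proof. by rewrite /position -cats1 count_cat /= addn0. Qed.

Lemma act_cat E s t x : act E (s ++ t) x = act (E ++ s) t (act E s x).
Proof.
elim: s E x => [|e s IH] E x /=; first by rewrite cats0.
by rewrite IH cat_rcons.
Qed.

Lemma act_permE E F s x : perm_eq E F -> act E s x = act F s x.
Proof.
elim: s E F x => //= e s IH E F x EF.
by rewrite (position_perm _ EF); apply: IH; rewrite -!cats1 perm_cat2r.
Qed.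

Lemma act_L E s x : x ∈ L -> act E s x ∈ L.
Proof. by elim: s E x => //= e s IH E x xL; apply: IH; exact: J_L. Qed.

Lemma act_mem E s x y : x ∈ L -> y ∈ L -> x ∈ y <-> act E s x ∈ act E s y.
Proof.
elim: s E x y => //= e s IH E x y xL yL.
by rewrite (J_mem (position E e)) //; apply: IH; exact: J_L.
Qed.

Lemma act_eq E s x y : x ∈ L -> y ∈ L -> x = y <-> act E s x = act E s y.
Proof.
elim: s E x y => //= e s IH E x y xL yL.
by rewrite (J_eq (position E e)) //; apply: IH; exact: J_L.
Qed.

Lemma act_upair E s x y : x ∈ L -> y ∈ L ->
  act E s (upair x y) = upair (act E s x) (act E s y).
Proof.
elim: s E x y => //= e s IH E x y xL yL.
by rewrite J_upair // IH //; exact: J_L.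
Qed.

Lemma act_Vset E s x : x ∈ L -> act E s (Vset x) = Vset (act E s x).
Proof.
elim: s E x => //= e s IH E x xL.
by rewrite J_Vset // IH //; exact: J_L.
Qed.

Lemma act_sub E s x y : x ∈ L -> y ∈ L -> x ⊆ y <-> act E s x ⊆ act E s y.
Proof.
elim: s E x y => //= e s IH E x y xL yL.
by rewrite (J_sub (position E e)) //; apply: IH; exact: J_L.
Qed.

Lemma act_grow E s x : x ∈ L -> Vset x ⊆ Vset (act E s x).
Proof.
elim: s E x => [E x _ z //|e s IH E x xL z /(@J_grow (position E e) x xL)].
exact: IH (J_L _ xL) z.
Qed.

Lemma act_ord E s x : x ∈ L -> is_ordinal x -> is_ordinal (act E s x).
Proof.
elim: s E x => //= e s IH E x xL ox.
by apply: IH; [exact: J_L|exact: J_ord].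
Qed.

(** An insertion into a set of size n happens at a position at most n, so it
    commutes with the embeddings J_(n+m), raising their index by one. *)
Lemma act_J E s m x : x ∈ L ->
  act E s (J (size E + m) x) = J (size (E ++ s) + m) (act E s x).
Proof.
elim: s E x => [|e s IH] E x xL /=; first by rewrite cats0.
rewrite J_comm //; last by apply: leq_trans (count_size _ _) _; rewrite leq_addr.
rewrite -addSn -(size_rcons E e) IH; last exact: J_L.
by rewrite cat_rcons.
Qed.

Lemma act_graph E s m y : y ∈ L ->
  act E s (gr (size E + m) y) = gr (size (E ++ s) + m) (act E s y).
Proof.
elim: s E y => [|e s IH] E y yL /=; first by rewrite cats0.
rewrite J_graph //; last by apply: leq_trans (count_size _ _) _; rewrite leq_addr.
rewrite -addSn -(size_rcons E e) IH; last exact: J_L.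
by rewrite cat_rcons.
Qed.

(** If e < f, then inserting e first raises the position of f by one, whereas
    inserting f leaves the position of e unchanged: this is the relation
    J_(l+1) ∘ J_k = J_k ∘ J_l for k <= l. *)
Lemma act_swap E e f x : is_ordinal e -> is_ordinal f -> x ∈ L ->
  act E [:: e; f] x = act E [:: f; e] x.
Proof.
wlog ef : e f / e ∈ f.
  move=> H oe o_f xL; case: (ord_trichotomy oe o_f) => [ef|->//|fe]; first exact: H.
  by apply: esym; exact: H.
move=> oe o_f xL; rewrite /= !position_rcons.
have -> : `[< e ∈ f >] = true by apply/asboolP.
have -> : `[< f ∈ e >] = false by apply/asboolP; exact: inV_asym.
rewrite addn0 addn1 -J_comm //; apply: sub_count => z /asboolP ze; apply/asboolP.
exact: ord_trans o_f ze ef.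
Qed.

Lemma act_perm E s t x : ords s -> x ∈ L -> perm_eq s t -> act E s x = act E t x.
Proof.
move=> os xL st; elim: s t E x os xL st => [|e s IH] t E x os xL st.
  by have /perm_nilP -> : perm_eq t [::] by rewrite perm_sym.
have et : e \in t by rewrite -(perm_mem st) mem_head.
have ot : ords t by move=> f; rewrite -(perm_mem st); exact: os.
have os' : ords s by move=> f fs; apply: os; rewrite in_cons fs orbT.
have oe : is_ordinal e by apply: os; exact: mem_head.
have [t1 [t2 tE]] : exists t1 t2, t = t1 ++ e :: t2.
  by case/splitPr: et => t1 t2; exists t1, t2.
have st' : perm_eq s (t1 ++ t2).
  by rewrite -(perm_cons e) (permPl st) tE -cat_rcons -cats1 -catA perm_catCA.
transitivity (act E (e :: t1 ++ t2) x).
  exact: (IH _ _ _ os' (J_L _ xL) st').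
rewrite tE; move: ot; rewrite tE => /ords_cat [ot1 _].
move=> {IH os st os' st' et tE}; elim: t1 E x xL ot1 => //= f t1 IH E x xL o_f.
have oof : is_ordinal f by apply: o_f; exact: mem_head.
have ot1 : ords t1 by move=> g gt; apply: o_f; rewrite in_cons gt orbT.
rewrite -IH //; last exact: J_L.
have := act_swap E oe oof xL; rewrite /= => ->.
by apply: act_permE; rewrite -!cats1 -!catA perm_cat2l (perm_catC [:: e]).
Qed.

(** * The finite-support limit *)

Definition stable (R : V -> V -> Prop) : Prop :=
  forall E s x y, x ∈ L -> y ∈ L -> R x y <-> R (act E s x) (act E s y).

Lemma stable_mem : stable inV. Proof. by move=> E s x y; exact: act_mem. Qed.
Lemma stable_eq : stable eq. Proof. by move=> E s x y; exact: act_eq. Qed.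

(** Comparison of two points of the direct limit: both are moved to a common
    support, and the relation [R] is tested there.  [R] is equality or
    membership. *)
Definition ptrel (R : V -> V -> Prop) (p q : seq V * V) : Prop :=
  exists s t, [/\ ords (p.1 ++ s), uniq (p.1 ++ s), perm_eq (p.1 ++ s) (q.1 ++ t) &
    R (act p.1 s p.2) (act q.1 t q.2)].

Definition missing (E G : seq V) : seq V := filter [predC E] G.

Lemma missing_perm E G : uniq E -> uniq G -> {subset E <= G} ->
  perm_eq (E ++ missing E G) G.
Proof.
move=> uE uG EG; apply: uniq_perm => //.
  rewrite cat_uniq uE filter_uniq // andbT; apply/hasPn => e.
  by rewrite mem_filter => /andP [].
move=> e; rewrite mem_cat mem_filter /=; case: (boolP (e \in E)) => //= /EG ->.
by [].
Qed.

Lemma missing_self G : missing G G = [::].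
Proof. by rewrite /missing -(filter_pred0 G); apply: eq_in_filter => e /= ->. Qed.

(** The outcome does not depend on the common support: two of them are included
    in a third one, and the insertions leading there are compared by
    [act_perm]. *)
Lemma ptrel_join R p q s t : stable R ->
  p.2 ∈ L -> q.2 ∈ L ->
  ords (p.1 ++ s) -> uniq (p.1 ++ s) -> perm_eq (p.1 ++ s) (q.1 ++ t) ->
  ptrel R p q <-> R (act p.1 s p.2) (act q.1 t q.2).
Proof.
move=> sR pL qL o u e; split; last by exists s, t.
move=> [s' [t' [o' u' e']]].
pose G := p.1 ++ s; pose G' := p.1 ++ s'.
pose v := missing G G'; pose v' := missing G' G.
have oGv : ords (G ++ v).
  by apply/ords_cat; split=> // f; rewrite mem_filter => /andP [_ /o'].
have vv' : perm_eq (G ++ v) (G' ++ v').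
  have uU : uniq (undup (G ++ G')) by exact: undup_uniq.
  have h K K' : uniq K -> uniq K' -> perm_eq (K ++ missing K K') (undup (K ++ K')).
    move=> uK uK'; apply: uniq_perm; [|exact: undup_uniq|].
      rewrite cat_uniq uK filter_uniq // andbT; apply/hasPn => f.
      by rewrite mem_filter => /andP [].
    move=> f; rewrite mem_undup !mem_cat mem_filter /=.
    by case: (f \in K).
  rewrite (permPl (h _ _ u u')) perm_sym (permPl (h _ _ u' u)).
  apply: uniq_perm; try exact: undup_uniq.
  by move=> f; rewrite !mem_undup !mem_cat orbC.
have key E x w w' z z' : x ∈ L -> perm_eq (E ++ w) G -> perm_eq (E ++ w') G' ->
    z = act E w x -> z' = act E w' x -> act G v z = act G' v' z'.
  move=> xL wG wG' -> ->.
  rewrite -(act_permE v _ wG) -(act_permE v' _ wG') -!act_cat.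
  have pe : perm_eq (E ++ w ++ v) (E ++ w' ++ v').
    rewrite !catA (perm_trans _ (perm_trans vv' _)) //; first by rewrite perm_cat2r.
    by rewrite perm_cat2r perm_sym.
  apply: act_perm => //; last by rewrite -(perm_cat2l E).
  move=> f fw; apply: oGv; rewrite mem_cat; move: fw; rewrite mem_cat => /orP [fw|->].
    by rewrite -(perm_mem wG) mem_cat fw orbT.
  by rewrite orbT.
have aL : act p.1 s p.2 ∈ L by exact: act_L.
have bL : act q.1 t q.2 ∈ L by exact: act_L.
have a'L : act p.1 s' p.2 ∈ L by exact: act_L.
have b'L : act q.1 t' q.2 ∈ L by exact: act_L.
rewrite (sR G v _ _ aL bL) (sR G' v' _ _ a'L b'L).
rewrite (key p.1 p.2 s s' _ _ pL (perm_refl _) (perm_refl _) erefl erefl).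
rewrite (key q.1 q.2 t t' _ _ qL _ _ erefl erefl) //; by rewrite perm_sym.
Qed.

Definition supported (a : V) (p : seq V * V) : Prop :=
  [/\ uniq p.1, forall e, e \in p.1 -> e ∈ a & p.2 ∈ L].

Definition lift_to (p : seq V * V) (G : seq V) : V := act p.1 (missing p.1 G) p.2.

Lemma lift_to_L p G : p.2 ∈ L -> lift_to p G ∈ L. Proof. exact: act_L. Qed.

Section Points.
Variable a : V.
Hypothesis oa : is_ordinal a.

Lemma supported_ords p : supported a p -> ords p.1.
Proof. by move=> [_ pa _] e /pa; exact: ord_in. Qed.

Lemma ptrel_lift R p q G : stable R -> supported a p -> supported a q ->
  uniq G -> (forall e, e \in G -> e ∈ a) ->
  {subset p.1 <= G} -> {subset q.1 <= G} ->
  ptrel R p q <-> R (lift_to p G) (lift_to q G).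
Proof.
move=> sR [up' pa pL] [uq qa qL] uG Ga pG qG.
have pp := missing_perm up' uG pG; have pq := missing_perm uq uG qG.
apply: ptrel_join => //.
- by move=> e; rewrite (perm_mem pp) => /Ga; exact: ord_in.
- by rewrite (perm_uniq pp).
- by rewrite (permPl pp) perm_sym.
Qed.

Lemma common_support (ps : seq (seq V * V)) :
  (forall p, p \in ps -> supported a p) ->
  exists G, [/\ uniq G, forall e, e \in G -> e ∈ a &
    forall p, p \in ps -> {subset p.1 <= G}].
Proof.
move=> psa; exists (undup (flatten [seq p.1 | p <- ps])); split.
- exact: undup_uniq.
- move=> e; rewrite mem_undup => /flatten_mapP [p pps].
  by have [_ pa _] := psa p pps; exact: pa.
- move=> p pps e ep; rewrite mem_undup; apply/flatten_mapP; by exists p.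
Qed.

Lemma ptrel_same R G x y : stable R -> supported a (G, x) -> supported a (G, y) ->
  ptrel R (G, x) (G, y) <-> R x y.
Proof.
move=> sR Gx Gy; have oG := supported_ords Gx.
case: Gx => uG _ xL; case: Gy => _ _ yL.
by rewrite (@ptrel_join R (G, x) (G, y) [::] [::]) //= cats0.
Qed.

Lemma supported_lift p G : supported a p -> uniq G -> (forall e, e \in G -> e ∈ a) ->
  supported a (G, lift_to p G).
Proof. by move=> [_ _ pL] uG Ga; split=> //; exact: lift_to_L. Qed.

Lemma ptrel_lift_self p G : supported a p -> uniq G -> (forall e, e \in G -> e ∈ a) ->
  {subset p.1 <= G} -> ptrel eq p (G, lift_to p G).
Proof.
move=> ps uG Ga pG; have Gs := supported_lift ps uG Ga.
rewrite (@ptrel_lift eq p (G, lift_to p G) G) //; last exact: stable_eq.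
by rewrite [in RHS]/lift_to /= missing_self.
Qed.

Lemma ptrel_congr R p p' q q' : stable R ->
  supported a p -> supported a p' -> supported a q -> supported a q' ->
  ptrel eq p p' -> ptrel eq q q' -> ptrel R p q <-> ptrel R p' q'.
Proof.
move=> sR sp sp' sq sq'.
have [|G [uG Ga pG]] := @common_support [:: p; p'; q; q'].
  by move=> r; rewrite !inE => /or4P [] /eqP ->.
have sG r : r \in [:: p; p'; q; q'] -> {subset r.1 <= G} by exact: pG.
rewrite (@ptrel_lift eq p p' G) ?(@ptrel_lift eq q q' G) ?(@ptrel_lift R p q G)
   ?(@ptrel_lift R p' q' G) //; try exact: stable_eq;
  try by apply: sG; rewrite !inE eqxx ?orbT.
by move=> -> ->.
Qed.

Lemma ptrel_refl p : supported a p -> ptrel eq p p.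
Proof. by case: p => G x sp; rewrite ptrel_same //; exact: stable_eq. Qed.

Lemma ptrel_common p q : supported a p -> supported a q ->
  exists G x y, [/\ supported a (G, x), supported a (G, y),
    ptrel eq p (G, x) & ptrel eq q (G, y)].
Proof.
move=> sp sq; have [|G [uG Ga pG]] := @common_support [:: p; q].
  by move=> r; rewrite !inE => /orP [] /eqP ->.
exists G, (lift_to p G), (lift_to q G); split; try exact: supported_lift;
 by apply: ptrel_lift_self => //; apply: pG; rewrite !inE eqxx ?orbT.
Qed.

End Points.

Definition ptmem (a : V) (p q : seq V * V) : Prop :=
  [/\ supported a p, supported a q & ptrel inV p q].

Lemma mem_setof_points a (Q : seq V * V -> Prop) (F : seq V * V -> V) z :
  z ∈ setof (fun z => exists p, [/\ supported a p, Q p & z = F p]) <->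
  exists p, [/\ supported a p, Q p & z = F p].
Proof.
have [[A f] aE] := cl_surj a; have [[B g] LE] := cl_surj L.
move: z; apply: (@mem_setof (seq A * B) (fun sb =>
  sval (cid (cl_surj (F ([seq cl (f i) | i <- sb.1], cl (g sb.2))))))).
move=> _ [[E x] [[_ /= Ea xL] _ ->]].
have [s sE] : exists s, E = [seq cl (f i) | i <- s].
  elim: E Ea => [|e E IH] Ea; first by exists [::].
  have [|s ->] := IH; first by move=> e' e'E; apply: Ea; rewrite in_cons e'E orbT.
  have := Ea e (mem_head _ _); rewrite aE; have [y ->] := cl_surj e.
  by move=> /mem_cl [i /cl_eq ->]; exists (i :: s).
have [b bE] : exists b, x = cl (g b).
  move: xL; rewrite LE; have [y ->] := cl_surj x.
  by move=> /mem_cl [b /cl_eq ->]; exists b.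
by exists (s, b); case: cid => y /= <-; rewrite -sE -bE.
Qed.

(** The Mostowski collapse of the finite-support limit, as a function on points;
    the value outside the well-founded case is arbitrary. *)
Definition ptval (a : V) : seq V * V -> V :=
  match pselect (well_founded (ptmem a)) with
  | left wf => Fix wf (fun _ => V) (fun p rec =>
      setof (fun z => exists q (h : ptmem a q p), z = rec q h))
  | right _ => fun _ => emptyV
  end.

Section Collapse.
Variable a : V.
Hypothesis oa : is_ordinal a.
Hypothesis wfa : well_founded (ptmem a).

Lemma mem_ptval p z : z ∈ ptval a p <-> exists2 q, ptmem a q p & z = ptval a q.
Proof.
have -> : ptval a p =
    setof (fun z => exists q, [/\ supported a q, ptmem a q p & z = ptval a q]).
  rewrite /ptval; case: pselect => // wf; rewrite Fix_eq => [|x f f' ff'].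
    congr setof; apply/funext => w; apply/propext.
    by split=> [[q [h ->]]|[q [_ h ->]]]; exists q; [split=> //; case: h|exists h].
  congr setof; apply/funext => w; apply/propext.
  by split=> -[q [h ->]]; exists q, h; rewrite ff'.
rewrite mem_setof_points; split=> [[q [_ h ->]]|[q h ->]]; exists q => //.
by split=> //; case: h.
Qed.

Lemma ptval_congr p q : supported a p -> supported a q -> ptrel eq p q ->
  ptval a p = ptval a q.
Proof.
move=> sp sq pq; apply: V_ext => z; rewrite !mem_ptval.
by split=> -[r [sr _ rp] ->]; exists r => //; split=> //;
  apply/(ptrel_congr oa stable_mem sr sr sp sq (ptrel_refl oa sr) pq).
Qed.

(** Extensionality of the limit.  Two points with the same collapse are moved to
    a common support; elements of the two underlying sets are again points with
    that support, of smaller rank, so that the induction hypothesis applies to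
    them. *)
Lemma ptval_inj p q : supported a p -> supported a q ->
  ptval a p = ptval a q -> ptrel eq p q.
Proof.
elim/(well_founded_ind wfa): p q => p IH q sp sq.
have [G [x [y [sx sy px qy]]]] := ptrel_common oa sp sq.
rewrite (ptval_congr sp sx px) (ptval_congr sq sy qy) => xy.
apply/(ptrel_congr oa stable_eq sp sx sq sy px qy)/(ptrel_same oa stable_eq sx sy).
have sin u v : supported a (G, v) -> u ∈ v -> supported a (G, u).
  by move=> [uG Ga vL] uv; split=> //; exact: Lin uv vL.
have below u v : supported a (G, v) -> u ∈ v -> ptmem a (G, u) (G, v).
  by move=> sv uv; have su := sin _ _ sv uv; split=> //; apply/(ptrel_same oa stable_mem su sv).
have at_p r : ptmem a r (G, x) -> ptmem a r p.
  move=> [sr _ rx]; split=> //.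
  by apply/(ptrel_congr oa stable_mem sr sr sp sx (ptrel_refl oa sr) px).
apply: V_ext => u; split=> [ux|uy].
- have su := sin _ _ sx ux.
  have : ptval a (G, u) ∈ ptval a (G, y) by rewrite -xy mem_ptval; exists (G, u) => //; exact: below.
  move=> /mem_ptval [r [sr _ ry] ur].
  have {}ur := IH _ (at_p _ (below _ _ sx ux)) r su sr ur.
  apply/(ptrel_same oa stable_mem su sy).
  by apply/(ptrel_congr oa stable_mem su sr sy sy ur (ptrel_refl oa sy)).
- have su := sin _ _ sy uy.
  have : ptval a (G, u) ∈ ptval a (G, x) by rewrite xy mem_ptval; exists (G, u) => //; exact: below.
  move=> /mem_ptval [r rx ur]; have [sr _ rx'] := rx.
  have {}ur := IH r (at_p _ rx) (G, u) sr su (esym ur).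
  apply/(ptrel_same oa stable_mem su sx).
  by apply/(ptrel_congr oa stable_mem sr su sx sx ur (ptrel_refl oa sx)).
Qed.

Lemma ptval_ptrel R p q : R = eq \/ R = inV -> supported a p -> supported a q ->
  R (ptval a p) (ptval a q) <-> ptrel R p q.
Proof.
move=> [] -> sp sq; first by split; [exact: ptval_inj|exact: ptval_congr].
rewrite mem_ptval; split=> [[r [sr _ rq] pr]|pq]; last by exists p.
apply/(ptrel_congr oa stable_mem sp sr sq sq _ (ptrel_refl oa sq)) => //.
exact: ptval_inj.
Qed.

Lemma ptval_same R G x y : R = eq \/ R = inV ->
  supported a (G, x) -> supported a (G, y) ->
  R (ptval a (G, x)) (ptval a (G, y)) <-> R x y.
Proof.
move=> HR sx sy; rewrite (ptval_ptrel HR sx sy); apply: (ptrel_same oa _ sx sy).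
by case: HR => ->; [exact: stable_eq|exact: stable_mem].
Qed.

Lemma ptval_lift p G : supported a p -> uniq G -> (forall e, e \in G -> e ∈ a) ->
  {subset p.1 <= G} -> ptval a p = ptval a (G, lift_to p G).
Proof.
move=> sp uG Ga pG; apply: (ptval_congr sp (supported_lift sp uG Ga)).
exact (ptrel_lift_self oa sp uG Ga pG).
Qed.

Lemma supported_in G x y : supported a (G, y) -> x ∈ y -> supported a (G, x).
Proof. by move=> [uG Ga yL] xy; split=> //; exact: Lin xy yL. Qed.

Lemma mem_ptval_at E x z (es : seq (seq V * V)) :
  supported a (E, x) -> (forall p, p \in es -> supported a p) ->
  z ∈ ptval a (E, x) ->
  exists G u, [/\ uniq G, forall e, e \in G -> e ∈ a, {subset E <= G},
    forall p, p \in es -> {subset p.1 <= G} &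
    u ∈ lift_to (E, x) G /\ z = ptval a (G, u)].
Proof.
move=> sx ses /mem_ptval [q [sq _ qx] ->].
have [|G [uG Ga pG]] := @common_support a [:: (E, x), q & es].
  by move=> r; rewrite !inE => /or3P [/eqP ->|/eqP ->|/ses].
have EG : {subset E <= G} by apply: (pG (E, x)); rewrite inE eqxx.
have qG : {subset q.1 <= G} by apply: pG; rewrite !inE eqxx orbT.
exists G, (lift_to q G); split=> //; first by move=> p pe; apply: pG; rewrite !inE pe !orbT.
split; last exact: ptval_lift.
by apply/(ptrel_lift oa stable_mem sq sx uG Ga qG EG).
Qed.

Lemma ptval_liftair G x y : supported a (G, x) -> supported a (G, y) ->
  ptval a (G, upair x y) = upair (ptval a (G, x)) (ptval a (G, y)).
Proof.
move=> sx sy; have [uG Ga xL] := sx; have [_ _ yL] := sy.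
have sxy : supported a (G, upair x y) by split=> //; exact: Lup.
apply: V_ext => z; rewrite mem_upair; split.
  move=> /(mem_ptval_at (es := [::]) sxy) [] // H [u [uH Ha GH _ []]].
  rewrite /lift_to /= act_upair // => /mem_upair [->|->] ->; [left|right].
    by rewrite (ptval_lift sx uH Ha GH).
  by rewrite (ptval_lift sy uH Ha GH).
by case=> ->; apply/(ptval_same (or_intror erefl)) => //; apply/mem_upair; [left|right].
Qed.

Lemma ptval_opair G x y : supported a (G, x) -> supported a (G, y) ->
  ptval a (G, opair x y) = opair (ptval a (G, x)) (ptval a (G, y)).
Proof.
move=> sx sy; have [uG Ga xL] := sx; have [_ _ yL] := sy.
by rewrite /opair !ptval_liftair //; split=> //; exact: Lup.
Qed.

Lemma ptval_transitive G y : supported a (G, y) -> is_ordinal y ->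
  transitive_set (ptval a (G, y)).
Proof.
move=> sy oy z /(mem_ptval_at (es := [::]) sy) [] // H [u [uH Ha GH _ [uy ->]]].
have sy' := supported_lift sy uH Ha; have su := supported_in sy' uy.
move=> w /(mem_ptval_at (es := [::]) su) [] // K [v [uK Ka HK _ [vu ->]]].
rewrite (ptval_lift sy uH Ha GH) (ptval_lift sy' uK Ka HK).
have oy' : is_ordinal (lift_to (G, y) H) by apply: act_ord => //; case: sy.
have sy2 := supported_lift sy' uK Ka.
have vy : v ∈ lift_to (H, lift_to (G, y) H) K.
  apply: ord_trans vu _; first by apply: act_ord => //; case: sy'.
  have [_ _ uL] := su; have [_ _ y'L] := sy'.
  by apply/(act_mem H (missing H K) uL y'L).
by apply/(ptval_same (or_intror erefl) (supported_in sy2 vy) sy2).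
Qed.

Lemma ptval_ord G y : supported a (G, y) -> is_ordinal y -> is_ordinal (ptval a (G, y)).
Proof.
move=> sy oy; split; first exact: ptval_transitive.
move=> z /(mem_ptval_at (es := [::]) sy) [] // H [u [uH Ha GH _ [uy ->]]].
apply: ptval_transitive; first exact: supported_in (supported_lift sy uH Ha) uy.
by apply: ord_in uy; apply: act_ord => //; case: sy.
Qed.

Definition ptmodel : V :=
  setof (fun z => exists p, [/\ supported a p, True & z = ptval a p]).

Lemma mem_ptmodel z : z ∈ ptmodel <-> exists2 p, supported a p & z = ptval a p.
Proof.
by rewrite mem_setof_points; split=> [[p [sp _ ->]]|[p sp ->]]; exists p.
Qed.

(** On points with support of size n, stage a has the embedding J_n (the case
    m = 0), and its successor stage has J_(n+1) (the case m = 1). *)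
Definition shift (m : nat) (p : seq V * V) : seq V * V := (p.1, J (size p.1 + m) p.2).

Lemma supported_shift m p : supported a p -> supported a (shift m p).
Proof. by move=> [uG Ga xL]; split=> //; exact: J_L. Qed.

Lemma lift_to_shift m p G : supported a p -> uniq G -> {subset p.1 <= G} ->
  lift_to (shift m p) G = J (size G + m) (lift_to p G).
Proof.
move=> [up' pa pL] uG pG; rewrite /lift_to /= act_J //.
by rewrite (perm_size (missing_perm up' uG pG)).
Qed.

Lemma lift_to_graph E m y G : supported a (E, y) -> uniq G -> {subset E <= G} ->
  lift_to (E, gr (size E + m) y) G = gr (size G + m) (lift_to (E, y) G).
Proof.
move=> [/= uE Ea yL] uG EG; rewrite /lift_to /= act_graph //.
by rewrite (perm_size (missing_perm uE uG EG)).
Qed.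

Lemma ptval_shift m p q : supported a p -> supported a q ->
  ptval a p = ptval a q -> ptval a (shift m p) = ptval a (shift m q).
Proof.
move=> sp sq /(ptval_inj sp sq) pq.
have [|G [uG Ga pG]] := @common_support a [:: p; q].
  by move=> r; rewrite !inE => /orP [] /eqP ->.
have PG : {subset p.1 <= G} by apply: pG; rewrite !inE eqxx.
have QG : {subset q.1 <= G} by apply: pG; rewrite !inE eqxx orbT.
rewrite (ptval_lift (supported_shift m sp) uG Ga PG).
rewrite (ptval_lift (supported_shift m sq) uG Ga QG) !lift_to_shift //.
by have /(ptrel_lift oa stable_eq sp sq uG Ga PG QG) -> := pq.
Qed.

Definition ptgraph (m : nat) : V :=
  setof (fun z => exists p,
    [/\ supported a p, True & z = opair (ptval a p) (ptval a (shift m p))]).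

Lemma mem_ptgraph m z : z ∈ ptgraph m <->
  exists2 p, supported a p & z = opair (ptval a p) (ptval a (shift m p)).
Proof.
rewrite (mem_setof_points a (fun _ => True)
  (fun p => opair (ptval a p) (ptval a (shift m p)))).
by split=> [[p [sp _ ->]]|[p sp ->]]; exists p.
Qed.

Lemma app_ptgraph m p : supported a p -> app (ptgraph m) (ptval a p) = ptval a (shift m p).
Proof.
move=> sp; have H : opair (ptval a p) (app (ptgraph m) (ptval a p)) ∈ ptgraph m.
  apply: (@theP (fun y => opair (ptval a p) y ∈ ptgraph m)).
  by exists (ptval a (shift m p)); apply/mem_ptgraph; exists p.
move: H => /mem_ptgraph [q sq /opair_inj [pq ->]].
by apply: ptval_shift.
Qed.

(** The hierarchy of the limit model is computed on a common support, where it
    is the hierarchy of [L]. *)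
Lemma ptval_Vrel E w y : supported a (E, w) -> supported a (E, y) ->
  ptval a (E, w) ∈ Vrel (fun z => z ∈ ptmodel) (ptval a (E, y)) <-> w ∈ Vset y.
Proof.
move: {2}(ptval a (E, y)) (erefl (ptval a (E, y))) => v.
elim/(well_founded_ind inV_wf): v E w y => v IH E w y yv sw sy.
have inm p : supported a p -> ptval a p ∈ ptmodel by move=> sp; apply/mem_ptmodel; exists p.
rewrite mem_Vrel mem_Vset; split.
  move=> [_ [c /(mem_ptval_at (es := [:: (E, w)]) sy) [] // ]].
    by move=> r; rewrite inE => /eqP ->.
  move=> G [b [uG Ga EG _ [byy ->]]] wb.
  have sy' := supported_lift sy uG Ga; have sw' := supported_lift sw uG Ga.
  have sb := supported_in sy' byy.
  have cb : ptval a (G, b) ∈ v.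
    by rewrite -yv (ptval_lift sy uG Ga EG); apply/(ptval_same (or_intror erefl) sb sy').
  apply/mem_Vset; apply/(act_mem E (missing E G)); try by [case: sw|apply: LVs; case: sy].
  rewrite act_Vset; last by case: sy.
  apply/mem_Vset; exists b => // u uw.
  have su := supported_in sw' uw.
  apply/(IH _ cb G u b erefl su sb); apply: wb.
  by rewrite (ptval_lift sw uG Ga EG); apply/(ptval_same (or_intror erefl) su sw').
move=> [b byy wb]; split; first exact: inm.
have sb := supported_in sy byy.
have cb : ptval a (E, b) ∈ v by rewrite -yv; apply/(ptval_same (or_intror erefl) sb sy).
exists (ptval a (E, b)); first by rewrite yv.
move=> z /(mem_ptval_at (es := [::]) sw) [] // G [u [uG Ga EG _ [uw ->]]].
have su := supported_in (supported_lift sw uG Ga) uw.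
have sb' := supported_lift sb uG Ga.
rewrite (ptval_lift sb uG Ga EG) in cb *.
apply/(IH _ cb G u _ erefl su sb').
have [_ _ wL] := sw; have [_ _ bL] := sb.
move: u uw {su}.
change (lift_to (E, w) G ⊆ Vset (lift_to (E, b) G)).
by rewrite -act_Vset //; apply/(act_sub _ _ wL (LVs bL)).
Qed.

Lemma mem_ptval_graph m E y z : supported a (E, y) ->
  z ∈ ptval a (E, gr (size E + m) y) <->
  exists G u, [/\ supported a (G, u), {subset E <= G},
    z = opair (ptval a (G, u)) (ptval a (shift m (G, u))) &
    opair u (J (size G + m) u) ∈ Vset (lift_to (E, y) G)].
Proof.
move=> sy; have [uE Ea yL] := sy.
have sg : supported a (E, gr (size E + m) y) by split=> //; exact: gr_L.
split.
  move=> /(mem_ptval_at (es := [::]) sg) [] // G [v [uG Ga EG _ []]].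
  rewrite lift_to_graph // => /mem_graph_below [vy [u uL vE]] ->; subst v.
  exists G, u; split=> //.
  by rewrite ptval_opair //; split=> //; exact: J_L.
move=> [G [u [su EG -> uy]]]; have [uG Ga uL] := su.
rewrite (ptval_lift sg uG Ga EG) -(ptval_opair su (supported_shift m su)).
have sg' := supported_lift sg uG Ga.
suff h : opair u (J (size G + m) u) ∈ lift_to (E, gr (size E + m) y) G.
  by apply/(ptval_same (or_intror erefl) (supported_in sg' h) sg').
by rewrite lift_to_graph //; apply/mem_graph_below; split=> //; exists u.
Qed.

(** Amenability: each level of the graph is represented by one point. *)
Lemma ptgraph_level m E y : supported a (E, y) ->
  setof (fun z => z ∈ ptgraph m /\ z ∈ Vrel (fun z => z ∈ ptmodel) (ptval a (E, y))) =
  ptval a (E, gr (size E + m) y).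
Proof.
move=> sy; apply: V_ext => z.
rewrite (@separation (ptgraph m)); last by move=> w [].
have sop G u : supported a (G, u) -> supported a (G, opair u (J (size G + m) u)).
  by move=> [uG Ga uL]; split=> //; apply: opair_L => //; exact: J_L.
rewrite mem_ptval_graph //; split.
  move=> [/mem_ptgraph [p sp ->]].
  have [|G [uG Ga pG]] := @common_support a [:: (E, y); p].
    by move=> r; rewrite !inE => /orP [] /eqP ->.
  have EG : {subset E <= G} by apply: (pG (E, y)); rewrite inE eqxx.
  have PG : {subset p.1 <= G} by apply: pG; rewrite !inE eqxx orbT.
  have sp' := supported_lift sp uG Ga; have sy' := supported_lift sy uG Ga.
  rewrite (ptval_lift sp uG Ga PG) (ptval_lift (supported_shift m sp) uG Ga PG).
  rewrite lift_to_shift // (ptval_lift sy uG Ga EG).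
  rewrite -(ptval_opair sp' (supported_shift m sp')).
  move=> /(ptval_Vrel (sop _ _ sp') sy') h.
  exists G, (lift_to p G); split=> //.
  by rewrite -(ptval_opair sp' (supported_shift m sp')).
move=> [G [u [su EG -> uy]]]; split; first by apply/mem_ptgraph; exists (G, u).
have [uG Ga uL] := su.
rewrite (ptval_lift sy uG Ga EG) -(ptval_opair su (supported_shift m su)).
by apply/ptval_Vrel => //; [exact: sop|exact: supported_lift].
Qed.

(** The next embedding is the extension of the current one to its own graph; on
    a support of size n this is J_n⁺(J_n) = J_(n+1). *)
Lemma extend_ptgraph : extend ptmodel (app (ptgraph 0)) (ptgraph 0) = ptgraph 1.
Proof.
rewrite /extend /ptgraph; congr setof; apply/funext => z; apply/propext.
rewrite -/(ptgraph 0); split.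
  move=> [c [/mem_ptmodel [[E y] sy ->] _]].
  rewrite ptgraph_level // app_ptgraph; last by case: sy => ? ? ?; split=> //; exact: gr_L.
  rewrite /shift /= !addn0 J_graph //; last by case: sy.
  rewrite -addn1 mem_ptval_graph; last first.
    by case: sy => ? ? ?; split=> //; exact: J_L.
  by move=> [G [u [su _ -> _]]]; exists (G, u).
move=> [[G u] [su _ ->]]; have [uG Ga uL] := su.
have vL : opair u (J (size G + 1) u) ∈ L by apply: opair_L => //; exact: J_L.
(* a level high enough for the pair; the embedding raises it further *)
have [y [yL oy vy]] := Vlam_cofinal hj vL.
have sy : supported a (G, y) by [].
exists (ptval a (G, y)); split; [by apply/mem_ptmodel; exists (G, y)|exact: ptval_ord|].
rewrite ptgraph_level // app_ptgraph; last by split=> //; exact: gr_L.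
rewrite /shift /= !addn0 J_graph // -(addn1 (size G)) mem_ptval_graph; last first.
  by split=> //; exact: J_L.
exists G, u; split=> //.
by rewrite /lift_to /= missing_self; exact: J_grow.
Qed.

Lemma Vrel_base c : c ∈ L -> Vrel (fun y => y ∈ L) c = Vset c.
Proof.
elim/(well_founded_ind inV_wf): c => c IH cL; apply: V_ext => w.
  rewrite mem_Vrel mem_Vset; split=> [[_ [b bc wb]]|[b bc wb]].
    by exists b => //; rewrite -IH //; exact: Lin bc cL.
  split; last by exists b => //; rewrite IH //; exact: Lin bc cL.
  by apply: Ltr (LVs cL) _ _; apply/mem_Vset; exists b.
Qed.

Lemma level_base c : c ∈ L ->
  setof (fun x => x ∈ j /\ x ∈ Vrel (fun y => y ∈ L) c) = gr 0 c.
Proof.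
  move=> cL; apply: V_ext => w; rewrite (@separation j); last by move=> u [].
  rewrite Vrel_base // mem_graph_below; 
  split=> [[wj wc]|[wc [x xL wE]]]; [|subst w]; split=> //.
    have [x [y [xL yL E]]] := proj1 (proj1 ej) w wj.
    by exists x => //; rewrite J0 (app_unique (proj1 ej) (y := y)) // -E.
  by rewrite J0; have [] := app_fun (proj1 ej) xL.
Qed.

(** At limits the embedding is the extension of the connecting map from stage 0;
    the empty support goes to one of size n, which takes the graph of J_0 to
    that of J_n. *)
Lemma extend_base : extend L (fun x => ptval a ([::], x)) j = ptgraph 0.
Proof.
rewrite /extend /ptgraph; congr setof; apply/funext => z; apply/propext.
split.
  move=> [c [cL oc]]; rewrite level_base // (mem_ptval_graph 0 (E := [::])) //.
  by move=> [G [u [su _ -> _]]]; exists (G, u).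
move=> [[G u] [su _ ->]]; have [uG Ga uL] := su.
have vL : opair u (J (size G + 0) u) ∈ L by apply: opair_L => //; exact: J_L.
have [y [yL oy vy]] := Vlam_cofinal hj vL.
exists y; split=> //; rewrite level_base // (mem_ptval_graph 0 (E := [::])) //.
by exists G, u; split=> //; exact: act_grow.
Qed.

End Collapse.

(** * The iteration coincides with the finite-support limit *)

Lemma supported_sub b a p : b ⊆ a -> supported b p -> supported a p.
Proof. by move=> ba [up' pb pL]; split=> // e /pb; exact: ba. Qed.

Lemma ptmem_wf_sub b a : b ⊆ a -> well_founded (ptmem a) -> well_founded (ptmem b).
Proof.
move=> ba wfa p; elim/(well_founded_ind wfa): p => p IH; constructor=> q [sq sp qp].
by apply: IH; split=> //; [exact: (supported_sub ba sq)|exact: (supported_sub ba sp)].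
Qed.

Section Successor.
Variable b : V.
Hypothesis ob : is_ordinal b.
Let a := succV b.
Let oa : is_ordinal a. Proof. exact: succV_ord. Qed.
Let ba : b ⊆ a. Proof. by move=> z zb; apply/mem_succV; left. Qed.
Let bina : b ∈ a. Proof. by apply/mem_succV; right. Qed.

Definition add_top (p : seq V * V) : seq V * V := (b :: p.1, p.2).

Lemma supported_notin p : supported b p -> b \notin p.1.
Proof. by move=> [_ pb _]; apply/negP => /pb; exact: inV_irrefl. Qed.

Lemma supported_add_top p : supported b p -> supported a (add_top p).
Proof.
move=> sp; have [up' pb pL] := sp; split=> //=.
  by rewrite up' supported_notin.
by move=> e; rewrite in_cons => /orP [/eqP ->//|/pb /ba].
Qed.

(** The top element [b] is above everything inserted, so it does not affect any
    position.  Hence the supports that contain [b] form a copy of the system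
    for [b] inside the one for [b + 1]. *)
Lemma act_add_top E s x : (forall e, e \in s -> e ∈ b) ->
  act (b :: E) s x = act E s x.
Proof.
elim: s E x => //= e s IH E x sb.
rewrite IH; last by move=> f fs; apply: sb; rewrite in_cons fs orbT.
rewrite /position /=.
have -> : `[< b ∈ e >] = false.
  by apply/asboolP => be; case: (inV_asym be); apply: sb; exact: mem_head.
by [].
Qed.

Lemma ptrel_add_top R p q : stable R -> supported b p -> supported b q ->
  ptrel R (add_top p) (add_top q) <-> ptrel R p q.
Proof.
move=> sR sp sq; have [up' pb pL] := sp; have [uq qb qL] := sq.
have [|G [uG Gb pG]] := @common_support b [:: p; q].
  by move=> r; rewrite !inE => /orP [] /eqP ->.
have PG : {subset p.1 <= G} by apply: pG; rewrite !inE eqxx.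
have QG : {subset q.1 <= G} by apply: pG; rewrite !inE eqxx orbT.
have sub E e : e \in missing E G -> e ∈ b.
  by rewrite mem_filter => /andP [_ /Gb].
rewrite (ptrel_lift ob sR sp sq uG Gb PG QG) /lift_to.
have pp := missing_perm up' uG PG; have pq := missing_perm uq uG QG.
rewrite (@ptrel_join R (add_top p) (add_top q) (missing p.1 G) (missing q.1 G)) //=.
- by rewrite !act_add_top //; exact: sub.
- move=> e; rewrite in_cons (perm_mem pp) => /orP [/eqP ->//|/Gb].
  exact: ord_in.
- rewrite (perm_mem pp) (perm_uniq pp) uG andbT.
  by apply/negP => /Gb; exact: inV_irrefl.
- by rewrite perm_cons (permPl pp) perm_sym.
Qed.

(** Inserting [b] above a support of size n acts as J_n: the connecting map to
    the successor stage is the embedding. *)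
Lemma ptrel_to_top p : supported b p -> ptrel eq p (add_top (shift 0 p)).
Proof.
move=> sp; have [up' pb pL] := sp; have bp := supported_notin sp.
rewrite (@ptrel_join eq p (add_top (shift 0 p)) [:: b] [::]) //=.
- rewrite addn0; congr (J _ _); apply/eqP; rewrite -all_count.
  by apply/allP => e /pb eb; apply/asboolP.
- exact: stable_eq.
- exact: J_L.
- by apply/ords_cat; split=> e; [move=> /pb; exact: ord_in|rewrite inE => /eqP ->].
- by rewrite cat_uniq up' /= orbF bp.
- by rewrite cats0 cats1 perm_rcons.
Qed.

Lemma supported_topP p : supported a p ->
  exists2 q, supported b q & ptrel eq p (add_top q).
Proof.
move=> sp; have [up' pa pL] := sp; case: (boolP (b \in p.1)) => bp; last first.
  have sp' : supported b p.
    split=> // e ep; have /mem_succV [//|eb] := pa e ep.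
    by rewrite -eb ep in bp.
  by exists (shift 0 p); [exact: supported_shift|exact: ptrel_to_top].
exists (rem b p.1, p.2).
  split=> //=; first exact: rem_uniq.
  move=> e; rewrite mem_rem_uniq // inE => /andP [/eqP eb /pa /mem_succV []] //.
rewrite (@ptrel_join eq p (add_top (rem b p.1, p.2)) [::] [::]) //=.
- exact: stable_eq.
- by rewrite cats0; exact (supported_ords oa sp).
- by rewrite cats0.
- by rewrite !cats0 perm_to_rem.
Qed.

Lemma ptmem_wf_succ : well_founded (ptmem b) -> well_founded (ptmem a).
Proof.
move=> wfb p; constructor=> q qp; have [sq _ _] := qp; move: q sq {p qp}.
suff main q p : supported b q -> supported a p -> ptrel eq p (add_top q) -> Acc (ptmem a) p.
  by move=> p sp; have [q sq pq] := supported_topP sp; exact: main sq sp pq.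
elim/(well_founded_ind wfb): q p => q IH p sq sp pq; constructor=> p' [sp' _ p'p].
have [q' sq' p'q'] := supported_topP sp'.
apply: (IH q') => //; split=> //.
apply/(ptrel_add_top stable_mem sq' sq).
have sq2 := supported_add_top sq; have sq2' := supported_add_top sq'.
by apply/(ptrel_congr oa stable_mem sp' sq2' sp sq2 p'q' pq).
Qed.

Hypothesis wfb : well_founded (ptmem b).
Let wfa : well_founded (ptmem a) := ptmem_wf_succ wfb.

Lemma ptval_add_top p : supported b p -> ptval a (add_top p) = ptval b p.
Proof.
elim/(well_founded_ind wfb): p => p IH sp; have sp' := supported_add_top sp.
apply: V_ext => z; rewrite (mem_ptval wfa) (mem_ptval wfb).
split=> [[q [sq _ qp] ->]|[q qp ->]].
  have [r sr qr] := supported_topP sq; have sr' := supported_add_top sr.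
  have rp : ptmem b r p.
    split=> //; apply/(ptrel_add_top stable_mem sr sp).
    by apply/(ptrel_congr oa stable_mem sq sr' sp' sp' qr (ptrel_refl oa sp')).
  by exists r => //; rewrite (ptval_congr oa wfa sq sr' qr) IH.
have [sq _ qp'] := qp; exists (add_top q); last by rewrite IH.
by split=> //; [exact: supported_add_top|apply/(ptrel_add_top stable_mem sq sp)].
Qed.

Lemma ptval_succ p : supported b p -> ptval a p = ptval b (shift 0 p).
Proof.
move=> sp; have sp0 := supported_shift 0 sp.
rewrite -(ptval_add_top sp0); apply: (ptval_congr oa wfa) (ptrel_to_top sp).
  exact: supported_sub sp.
exact: supported_add_top.
Qed.

Lemma ptmodel_succ : ptmodel a = ptmodel b.
Proof.
apply: V_ext => z; rewrite !mem_ptmodel; split=> -[p sp ->].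
  have [q sq pq] := supported_topP sp; exists q => //.
  by rewrite -ptval_add_top //; exact: (ptval_congr oa wfa sp (supported_add_top sq) pq).
by exists (add_top p); [exact: supported_add_top|rewrite ptval_add_top].
Qed.

Lemma ptgraph_succ : ptgraph a 0 = ptgraph b 1.
Proof.
have E p : supported b p ->
    ptval a (shift 0 (add_top p)) = ptval b (shift 1 p).
  move=> sp; rewrite -ptval_add_top; last exact: supported_shift.
  by rewrite /shift /add_top /= addn0 addn1.
apply: V_ext => z; rewrite !mem_ptgraph; split=> -[p sp ->].
  have [q sq pq] := supported_topP sp; exists q => //.
  have sq' := supported_add_top sq.
  have pq' := ptval_congr oa wfa sp sq' pq.
  by rewrite (ptval_shift oa wfa 0 sp sq' pq') pq' E // ptval_add_top.
by exists (add_top p); [exact: supported_add_top|rewrite E // ptval_add_top].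
Qed.

End Successor.

Definition describes (a : V) (s : Stage) : Prop :=
  [/\ model s = ptmodel a, emb s = ptgraph a 0 &
      forall b p, b ∈ a \/ b = a -> supported b p -> bond s b (ptval b p) = ptval a p].

Lemma describes_succ b s : is_ordinal b -> well_founded (ptmem b) ->
  describes b s -> describes (succV b) (stage_succ s (succV b)).
Proof.
move=> ob wfb [ms es bs]; split=> /=.
- by rewrite ms ptmodel_succ.
- by rewrite ms es extend_ptgraph // ptgraph_succ.
move=> c p cb sp; case: pselect => [cE|cS] /=; first by rewrite cE.
case: cb => // /mem_succV cb; rewrite bs // es.
have sbp : supported b p.
  by case: cb => [cb|<-//]; apply: supported_sub sp => z zc; exact: ord_trans zc cb.
by rewrite app_ptgraph // ptval_succ.
Qed.

Lemma supported_empty p : supported emptyV p -> p.1 = [::].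
Proof.
case: p => -[//|e E] x [_ h _]; by case: (mem_emptyV (h e (mem_head _ _))).
Qed.

Lemma supported_nil a x : x ∈ L -> supported a ([::], x).
Proof. by []. Qed.

Lemma ptrel_nil R x y : stable R -> x ∈ L -> y ∈ L ->
  ptrel R ([::], x) ([::], y) <-> R x y.
Proof.
by move=> sR xL yL; apply: (ptrel_same emptyV_ord sR); exact: supported_nil.
Qed.

Lemma ptmem_wf_empty : well_founded (ptmem emptyV).
Proof.
move=> p; constructor=> -[E x] [sx _ _].
have /= E0 := supported_empty sx; subst E; case: sx => _ _ /= xL.
elim/(well_founded_ind inV_wf): x xL => x IH xL.
constructor=> -[E y] [sy _]; have /= E0 := supported_empty sy; subst E.
have [_ _ /= yL] := sy; move=> /(ptrel_nil stable_mem yL xL) yx; exact: IH.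
Qed.

Lemma ptval_empty x : x ∈ L -> ptval emptyV ([::], x) = x.
Proof.
elim/(well_founded_ind inV_wf): x => x IH xL; apply: V_ext => z.
rewrite (mem_ptval ptmem_wf_empty); split=> [[[E y] [sy _]]|zx].
  have /= E0 := supported_empty sy; subst E.
  have [_ _ /= yL] := sy; move=> /(ptrel_nil stable_mem yL xL) yx ->.
  by rewrite IH.
have zL := Lin Ltr zx xL; exists ([::], z); last by rewrite IH.
by split=> //; apply/(ptrel_nil stable_mem zL xL).
Qed.

Lemma describes_empty : describes emptyV (stage0 lam j).
Proof.
split=> /=.
- apply: V_ext => z; rewrite mem_ptmodel; split=> [zL|[[E x] sx ->]].
    by exists ([::], z) => //; rewrite ptval_empty.
  have /= E0 := supported_empty sx; subst E; have [_ _ /= xL] := sx.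
  by rewrite ptval_empty.
- apply: V_ext => z; rewrite mem_ptgraph; split=> [zj|[[E x] sx ->]].
    have [x [y [xL yL zE]]] := proj1 (proj1 ej) z zj; exists ([::], x) => //.
    rewrite zE /shift /= !ptval_empty //; last exact: (J_L 0 xL).
    by rewrite (app_unique (proj1 ej) (y := y)) // -zE.
  have /= E0 := supported_empty sx; subst E; have [_ _ /= xL] := sx.
  rewrite /shift /= !ptval_empty //; last exact: (J_L 0 xL).
  by have [] := app_fun (proj1 ej) xL.
- by move=> b p [/mem_emptyV//|->].
Qed.

Section Limit.
Variable g : V.
Hypothesis og : is_ordinal g.
Hypothesis g0 : g <> emptyV.
Hypothesis gS : ~ exists b, g = succV b.
Variable S : V -> Stage.
Hypothesis wfS : forall b, b ∈ g -> well_founded (ptmem b).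
Hypothesis dS : forall b, b ∈ g -> describes b (S b).

Let og_in b : b ∈ g -> is_ordinal b. Proof. exact: ord_in. Qed.
Let g_sub b : b ∈ g -> b ⊆ g. Proof. by move=> bg z zb; exact: ord_trans zb bg. Qed.

Lemma supported_below p : supported g p -> exists2 b, b ∈ g & supported b p.
Proof.
case: p => E x [/= uE Eg xL].
suff [b bg Eb] : exists2 b, b ∈ g & forall e, e \in E -> e ∈ b by exists b.
elim: E Eg {uE} => [|e E IH] Eg; first by have [b bg] := emptyVP g0; exists b.
have eg : e ∈ g by apply: Eg; exact: mem_head.
have [|b bg Eb] := IH; first by move=> f fE; apply: Eg; rewrite in_cons fE orbT.
have seg := succV_in_limit og gS eg.
have eS : e ∈ succV e by apply/mem_succV; right.
case: (ord_trichotomy (og_in eg) (og_in bg)) => [eb|eb|be].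
- by exists b => // f; rewrite in_cons => /orP [/eqP ->|/Eb].
- exists (succV e) => // f; rewrite in_cons => /orP [/eqP ->//|/Eb].
  by rewrite -eb => fe; apply/mem_succV; left.
- exists (succV e) => // f; rewrite in_cons => /orP [/eqP ->//|/Eb fb].
  by apply/mem_succV; left; exact: ord_trans (og_in eg) fb be.
Qed.

Definition at_stage (b : V) (p : seq V * V) : V * V := (b, ptval b p).

Lemma dl_pointP c : dl_point S g c <->
  exists b p, [/\ b ∈ g, supported b p & c = at_stage b p].
Proof.
case: c => b x; rewrite /dl_point /=; split=> [[bg]|[c [p [cg sp [-> ->]]]]].
  have [-> _ _] := dS bg; rewrite mem_ptmodel => -[p sp ->].
  by exists b, p.
by split=> //; have [-> _ _] := dS cg; rewrite mem_ptmodel; exists p.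
Qed.

(** The comparison of two points of the direct limit of the stages takes place
    at some later stage, whose elements are again compared by supports. *)
Lemma dl_relE R b c p q : R = eq \/ R = inV -> b ∈ g -> c ∈ g ->
  supported b p -> supported c q ->
  dl_rel S g R (at_stage b p) (at_stage c q) <-> ptrel R p q.
Proof.
move=> HR bg cg sp sq.
have value d : d ∈ g -> b ⊆ d -> c ⊆ d ->
    R (bond (S d) b (ptval b p)) (bond (S d) c (ptval c q)) <-> ptrel R p q.
  move=> dg bd cd; have od := og_in dg; have [_ _ bondE] := dS dg.
  rewrite !bondE //; [|exact: ord_sub (og_in cg) od cd|exact: ord_sub (og_in bg) od bd].
  exact: (ptval_ptrel od (wfS dg) HR (supported_sub bd sp) (supported_sub cd sq)).
split=> [[_ _ [d [dg bd cd]]]|pq]; first by move/(value d dg bd cd).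
split; [by apply/dl_pointP; exists b, p|by apply/dl_pointP; exists c, q|].
case: (ord_trichotomy (og_in bg) (og_in cg)) => [bc|bc|cb].
- have bc' : b ⊆ c by move=> z zb; exact: ord_trans (og_in cg) zb bc.
  by exists c; split=> //; apply/value.
- by exists b; split=> //; [rewrite bc|apply/value => //; rewrite bc].
- have cb' : c ⊆ b by move=> z zc; exact: ord_trans (og_in bg) zc cb.
  by exists b; split=> //; apply/value.
Qed.

Let eqeq : @eq V = @eq V \/ @eq V = inV. Proof. by left. Qed.
Let inin : inV = @eq V \/ inV = inV. Proof. by right. Qed.

Lemma dl_class_eq b c p q : b ∈ g -> c ∈ g -> supported b p -> supported c q ->
  dl_class S g (at_stage b p) = dl_class S g (at_stage c q) <-> ptrel eq p q.
Proof.
move=> bg cg sp sq; have sub := fun b bg p => @supported_sub b g p (@g_sub b bg).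
split=> [E|pq].
  apply/(dl_relE eqeq bg cg sp sq); rewrite -/(dl_class S g (at_stage b p) _) E.
  by apply/(dl_relE eqeq cg cg sq sq); exact (ptrel_refl og (sub _ cg _ sq)).
apply/funext => r; apply/propext.
have [/dl_pointP [d [t [dg st ->]]]|nr] := pselect (dl_point S g r); last first.
  by split=> -[_ /nr].
rewrite /dl_class (dl_relE eqeq bg dg sp st) (dl_relE eqeq cg dg sq st).
have st' := sub _ dg _ st.
apply: (ptrel_congr og stable_eq (sub _ bg _ sp) (sub _ cg _ sq) st' st' pq).
exact (ptrel_refl og st').
Qed.

Let supp b p : b ∈ g -> supported b p -> supported g p.
Proof. by move=> bg; exact: supported_sub (g_sub bg). Qed.

Lemma dl_mem_point c d : dl_mem S g c d ->
  exists b p, [/\ b ∈ g, supported b p & c = dl_class S g (at_stage b p)].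
Proof.
move=> [r [r' [-> _ [/dl_pointP [b [p [bg sp ->]]] _ _]]]].
by exists b, p.
Qed.

Lemma dl_memE b c p q : b ∈ g -> c ∈ g -> supported b p -> supported c q ->
  dl_mem S g (dl_class S g (at_stage b p)) (dl_class S g (at_stage c q)) <->
  ptrel inV p q.
Proof.
move=> bg cg sp sq; split=> [[r [r' [E E' rr']]]|pq]; last first.
  by exists (at_stage b p), (at_stage c q); split=> //; apply/(dl_relE inin bg cg).
have [/dl_pointP [d [t [dg st rE]]] /dl_pointP [d' [t' [dg' st' rE']]] _] := rr'.
subst r r'; move: rr' => /(dl_relE inin dg dg' st st').
move: E E' => /(dl_class_eq bg dg sp st) pt /(dl_class_eq cg dg' sq st') qt.
by move/(ptrel_congr og stable_mem (supp bg sp) (supp dg st) (supp cg sq) (supp dg' st') pt qt).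
Qed.

Lemma dl_mem_wf : well_founded (dl_mem S g) <-> well_founded (ptmem g).
Proof.
split=> [wf p|wf].
  constructor=> q [sq _ _]; have [b bg sbq] := supported_below sq.
  move: q {p} sq sbq.
  suff main c : Acc (dl_mem S g) c -> forall b q, b ∈ g -> supported b q ->
      c = dl_class S g (at_stage b q) -> Acc (ptmem g) q.
    by move=> q _ sq; exact: main (wf _) b q bg sq erefl.
  elim=> {}c _ IH d q dg sq cE; constructor=> r [sr _ rq].
  have [e eg ser] := supported_below sr.
  apply: (IH (dl_class S g (at_stage e r)) _ e r) => //.
  by rewrite cE; apply/dl_memE.
have main p : supported g p -> forall b, b ∈ g -> supported b p ->
    Acc (dl_mem S g) (dl_class S g (at_stage b p)).
  elim/(well_founded_ind wf): p => p IH sp b bg sbp; constructor=> c cp.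
  have [d [q [dg sq cE]]] := dl_mem_point cp; subst c.
  move: cp => /(dl_memE dg bg sq sbp) qp.
  by apply: IH => //; [split=> //|]; exact: supp dg sq.
move=> c; constructor=> d /dl_mem_point [b [p [bg sp ->]]].
exact: main (supp bg sp) _ bg sp.
Qed.

Lemma dl_collapse_class (wf : well_founded (dl_mem S g)) b p :
  b ∈ g -> supported b p ->
  dl_collapse wf (dl_class S g (at_stage b p)) = ptval g p.
Proof.
have wfg : well_founded (ptmem g) by apply/dl_mem_wf.
elim/(well_founded_ind wfg): p b => p IH b bg sp; rewrite dl_collapseE.
have wit d z : dl_mem S g d (dl_class S g (at_stage b p)) -> z = dl_collapse wf d ->
    exists q, [/\ supported g q, ptmem g q p & z = ptval g q].
  move=> dp ->; have [e [q [eg sq dE]]] := dl_mem_point dp; subst d.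
  have sgq := supp eg sq; move: dp => /(dl_memE eg bg sq sp) qp.
  have qp' : ptmem g q p by split=> //; exact: supp bg sp.
  by exists q; split=> //; exact: IH.
have -> : (fun z => exists2 d, dl_mem S g d (dl_class S g (at_stage b p)) &
                     z = dl_collapse wf d) =
    (fun z => exists q, [/\ supported g q, ptmem g q p & z = ptval g q]).
  apply/funext => z; apply/propext; split=> [[d dp zE]|[q [sq qp ->]]].
    exact: wit dp zE.
  have [e eg seq] := supported_below sq; have [_ _ qp'] := qp.
  exists (dl_class S g (at_stage e q)); first by apply/dl_memE.
  by rewrite IH.
apply: V_ext => z; rewrite mem_setof_points (mem_ptval wfg).
by split=> [[q [sq qp ->]]|[q qp ->]]; exists q => //; split=> //; case: qp.
Qed.

Let empty_in : emptyV ∈ g.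
Proof.
case: (ord_trichotomy emptyV_ord og) => [//|E|/mem_emptyV//].
by case: g0.
Qed.

Lemma describes_limit (wf : well_founded (dl_mem S g)) :
  describes g (stage_limit wf lam j).
Proof.
have wfg : well_founded (ptmem g) by apply/dl_mem_wf.
split=> /=.
- rewrite /ptmodel; congr setof; apply/funext => z; apply/propext; split.
    move=> [b [x [/dl_pointP [c [p [cg sp [-> ->]]]] ->]]].
    exists p; split=> //; first exact: supp cg sp.
    exact: dl_collapse_class.
  move=> [p [sp _ ->]]; have [b bg sbp] := supported_below sp.
  exists b, (ptval b p); split; first by apply/dl_pointP; exists b, p.
  by apply: esym; exact: dl_collapse_class.
- rewrite -(extend_base og wfg) /extend; congr setof; apply/funext => z; apply/propext.
  have E a : a ∈ L ->
      dl_collapse wf (dl_class S g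
        (emptyV, setof (fun x => x ∈ j /\ x ∈ Vrel (inV^~ L) a))) =
      ptval g ([::], setof (fun x => x ∈ j /\ x ∈ Vrel (inV^~ L) a)).
    move=> aL; set X := setof _.
    have XL : X ∈ L by rewrite /X level_base //; exact: gr_L.
    rewrite -(dl_collapse_class wf empty_in (supported_nil emptyV XL)).
    by rewrite /at_stage ptval_empty.
  by split=> -[a [aL oa za]]; exists a; split=> //; move: za; rewrite E.
move=> b p bg sp; case: pselect => [bE|bE] /=; first by rewrite bE.
case: bg => [bg|//]; exact: dl_collapse_class.
Qed.

End Limit.

Lemma stage_describes a : is_ordinal a ->
  (stage lam j a <-> well_founded (ptmem a)) /\
  (forall s, stage lam j a = Some s -> describes a s).
Proof.
elim/(well_founded_ind inV_wf): a => a IH oa.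
have [a0|a0] := pselect (a = emptyV).
  rewrite a0 stage_emptyV; split; first by split=> _; [exact: ptmem_wf_empty|exact: isT].
  by move=> s [<-]; exact: describes_empty.
have [[b ab]|aS] := pselect (exists b, a = succV b).
  subst a; have bS : b ∈ succV b by apply/mem_succV; right.
  have ob := ord_in oa bS; have [wfb db] := IH b bS ob.
  rewrite stage_succV; split; last first.
    move=> s; case E : (stage lam j b) => [t|] /= => [[<-]|//].
    have wb : well_founded (ptmem b) by apply/wfb; rewrite E.
    exact: (describes_succ ob wb (db t E)).
  split=> [|wfa].
    case E : (stage lam j b) => [t|] /= => [_|//].
    have wb : well_founded (ptmem b) by apply/wfb; rewrite E.
    exact: (ptmem_wf_succ ob wb).
  have : well_founded (ptmem b).
    by apply: ptmem_wf_sub wfa => z zb; apply/mem_succV; left.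
  by move=> /wfb; case: (stage lam j b).
pose S b := odflt (stage0 lam j) (if pselect (b ∈ a) then stage lam j b else None).
have limE := stage_limitE lam j a0 aS; rewrite /= -/S in limE.
have reach : (forall b, b ∈ a -> stage lam j b) ->
    (forall b, b ∈ a -> well_founded (ptmem b)) /\ (forall b, b ∈ a -> describes b (S b)).
  move=> H; split=> b ba; have [wfb db] := IH b ba (ord_in oa ba).
    by apply/wfb; exact: H.
  rewrite /S; case: (pselect (b ∈ a)) => [_|//] /=.
  by move: (H b ba); case E : (stage lam j b) => [s|//] _; exact: (db s E).
split; last first.
  move=> s /limE [/reach [wfS dS] [wf ->]].
  exact: (describes_limit oa a0 aS wfS dS).
split.
  case E : (stage lam j a) => [s|//] _.
  have /limE [/reach [wfS dS] [wf _]] := E.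
  by move/(dl_mem_wf oa a0 aS wfS dS): wf.
move=> wfa.
have all_b b : b ∈ a -> stage lam j b.
  move=> ba; have [wfb _] := IH b ba (ord_in oa ba); apply/wfb.
  by apply: ptmem_wf_sub wfa => z zb; exact: ord_trans zb ba.
have [wfS dS] := reach all_b.
have wf : well_founded (dl_mem S a) by apply/(dl_mem_wf oa a0 aS wfS dS).
have -> : stage lam j a = Some (stage_limit wf lam j) by apply/limE; split=> //; exists wf.
by [].
Qed.

(** * Reduction to countable ordinals *)

(** A map that preserves the order of the ordinals in [S] preserves positions,
    hence all comparisons of points supported in [S]. *)
Section OrderEmbedding.
Variables (S : V -> Prop) (pi : V -> V).
Hypothesis ordS : forall x, S x -> is_ordinal x.
Hypothesis incr : forall x y, S x -> S y -> x ∈ y -> pi x ∈ pi y.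

Lemma incr_iff x y : S x -> S y -> (pi x ∈ pi y <-> x ∈ y).
Proof.
move=> Sx Sy; split; last exact: incr.
case: (ord_trichotomy (ordS Sx) (ordS Sy)) => [//|->|yx] pxy.
  by case: (inV_irrefl pxy).
by case: (inV_asym pxy); exact: incr.
Qed.

Lemma incr_inj x y : S x -> S y -> pi x = pi y -> x = y.
Proof.
move=> Sx Sy E; case: (ord_trichotomy (ordS Sx) (ordS Sy)) => [xy|//|yx].
  by have := incr Sx Sy xy; rewrite E => /inV_irrefl.
by have := incr Sy Sx yx; rewrite E => /inV_irrefl.
Qed.

Lemma act_map E s x : (forall e, e \in E ++ s -> S e) ->
  act (map pi E) (map pi s) x = act E s x.
Proof.
elim: s E x => //= e s IH E x ES.
have Se : S e by apply: ES; rewrite mem_cat mem_head orbT.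
have -> : position (map pi E) (pi e) = position E e.
  rewrite /position count_map; apply: eq_in_count => f fE /=.
  have Sf : S f by apply: ES; rewrite mem_cat fE.
  by apply/asboolP/asboolP => /incr_iff; apply.
by rewrite -map_rcons IH // cat_rcons.
Qed.

Definition map_support (p : seq V * V) : seq V * V := (map pi p.1, p.2).

Lemma ptmem_map a a' p q : is_ordinal a -> is_ordinal a' ->
  (forall e, S e -> e ∈ a -> pi e ∈ a') ->
  (forall e, e \in p.1 -> S e) -> (forall e, e \in q.1 -> S e) ->
  ptmem a p q -> ptmem a' (map_support p) (map_support q).
Proof.
move=> oa oa' aa' pS qS [sp sq pq].
have smap r : (forall e, e \in r.1 -> S e) -> supported a r ->
    supported a' (map_support r).
  move=> rS [ur ra rL]; split=> //=.
    by rewrite map_inj_in_uniq // => e f /rS Se /rS Sf; exact: incr_inj.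
  by move=> _ /mapP [e er ->]; apply: aa'; [exact: rS|exact: ra].
split; try exact: smap.
pose G := undup (p.1 ++ q.1).
have uG : uniq G by exact: undup_uniq.
have GS e : e \in G -> S e by rewrite mem_undup mem_cat => /orP [/pS|/qS].
have Ga e : e \in G -> e ∈ a.
  by rewrite mem_undup mem_cat; case: sp sq => _ pa _ [_ qa _] /orP [/pa|/qa].
have pG : {subset p.1 <= G} by move=> e ep; rewrite mem_undup mem_cat ep.
have qG : {subset q.1 <= G} by move=> e eq; rewrite mem_undup mem_cat eq orbT.
have [up' _ _] := sp; have [uq _ _] := sq.
have pp := missing_perm up' uG pG; have qq := missing_perm uq uG qG.
have catS r : perm_eq (r ++ missing r G) G -> forall e, e \in r ++ missing r G -> S e.
  by move=> rG e; rewrite (perm_mem rG); exact: GS.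
exists (map pi (missing p.1 G)), (map pi (missing q.1 G)); rewrite /= -!map_cat; split.
- move=> _ /mapP [e ep ->]; apply: ord_in oa' _; apply: aa'; first exact: catS ep.
  by apply: Ga; rewrite -(perm_mem pp).
- rewrite map_inj_in_uniq ?(perm_uniq pp) // => e f ep fp.
  by apply: incr_inj; [exact: catS ep|exact: catS fp].
- by apply: perm_map; rewrite (permPl pp) perm_sym.
- rewrite !act_map; try exact: catS.
  exact/(ptrel_lift oa stable_mem sp sq uG Ga pG qG).
Qed.

End OrderEmbedding.

(** For [x] in [S] this is the position of [x] in the order formed by [S]. *)
Definition order_type (S : V -> Prop) : V -> V :=
  recV (fun rec x => setof (fun z => exists2 y, y ∈ x /\ S y & z = rec y)).

Lemma mem_order_type S x z :
  z ∈ order_type S x <-> exists2 y, y ∈ x /\ S y & z = order_type S y.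
Proof.
rewrite {1}/order_type recVE (@replacement x
  (fun y => if pselect (y ∈ x) then order_type S y else emptyV)); last first.
  by move=> w [y [yx _] ->]; exists y.
split=> -[y [yx Sy] zE]; exists y => //; move: zE;
  by case: (pselect (y ∈ x)) => [?|//].
Qed.

Lemma order_type_ord S x : is_ordinal x -> is_ordinal (order_type S x).
Proof.
move=> ox; have tr y : is_ordinal y -> transitive_set (order_type S y).
  move=> oy z /mem_order_type [u [uy Su] ->] w /mem_order_type [v [vu Sv] ->].
  by apply/mem_order_type; exists v => //; split=> //; exact: ord_trans vu uy.
split; first exact: tr.
by move=> y /mem_order_type [u [ux _] ->]; apply: tr; exact: ord_in ux.
Qed.

Lemma not_wf_descending (T : Type) (R : T -> T -> Prop) :
  ~ well_founded R -> exists D : nat -> T, forall n, R (D n.+1) (D n).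
Proof.
move=> /existsNP [p0 np0].
have nextE p : exists q, ~ Acc R p -> R q p /\ ~ Acc R q.
  have [ap|np] := pselect (Acc R p); first by exists p.
  have [[q [qp nq]]|nex] := pselect (exists q, R q p /\ ~ Acc R q); first by exists q.
  case: np; constructor=> q qp; apply: contrapT => nq; apply: nex; by exists q.
have [next nextP] := boolp.choice nextE.
exists (fun n => iter n next p0) => n.
suff nacc : ~ Acc R (iter n next p0) by have [] := nextP _ nacc.
by elim: n => //= n IH; have [] := nextP _ IH.
Qed.

Lemma descending_not_wf (T : Type) (R : T -> T -> Prop) (D : nat -> T) :
  (forall n, R (D n.+1) (D n)) -> ~ well_founded R.
Proof.
move=> DR wf; suff H : forall p n, D n = p -> False by exact: (H (D 0) 0).
elim/(well_founded_ind wf) => p IH n E.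
by apply: (IH (D n.+1) _ n.+1 erefl); rewrite -E.
Qed.

(** The ordinals in the supports of a descending sequence are indexed by pairs
    of natural numbers, so their order type is countable. *)
Lemma ptmem_wf_countable :
  (forall b, b ∈ omega1 -> well_founded (ptmem b)) ->
  forall a, is_ordinal a -> well_founded (ptmem a).
Proof.
move=> wfc a oa; apply: contrapT => /not_wf_descending [D DR].
have sD n : supported a (D n) by case: (DR n).
pose S e := exists n, e \in (D n).1.
have Sa e : S e -> e ∈ a by move=> [n en]; case: (sD n) => _ h _; exact: h.
have ordS e : S e -> is_ordinal e by move=> /Sa; exact: ord_in.
pose pi := order_type S; pose a' := pi a.
have oa' : is_ordinal a' by exact: order_type_ord.
have incr x y : S x -> S y -> x ∈ y -> pi x ∈ pi y.
  by move=> Sx _ xy; apply/mem_order_type; exists x.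
have ca' : countable a'.
  (* the k-th ordinal in the n-th support, moved to its position *)
  pose h (nk : nat * nat) := pi (nth emptyV (D nk.1).1 nk.2).
  have hP z : exists nk, z ∈ a' -> z = h nk.
    have [za|nza] := pselect (z ∈ a'); last by exists (0, 0).
    move: za => /mem_order_type [e [ea [n en]] ->].
    by exists (n, index e (D n).1) => _; rewrite /h /= nth_index.
  have [f fP] := boolp.choice hP.
  exists (fun z => pickle (f z)) => y z /fP yE /fP zE.
  by move=> /(pcan_inj pickleK) E; rewrite yE zE E.
have wfa' : well_founded (ptmem a') by apply: wfc; apply/mem_omega1.
apply: (@descending_not_wf _ (ptmem a') (fun n => map_support pi (D n))) wfa' => n.
apply: (ptmem_map ordS incr oa oa') (DR n).
- by move=> e Se ea; apply/mem_order_type; exists e.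
- by move=> e en; exists n.+1.
- by move=> e en; exists n.
Qed.

Lemma model_wfE a : is_ordinal a -> model_wf lam j a <-> well_founded (ptmem a).
Proof. by move=> oa; have [] := stage_describes oa. Qed.

Lemma model_wf_sub a b : is_ordinal a -> is_ordinal b -> b ⊆ a ->
  model_wf lam j a -> model_wf lam j b.
Proof. by move=> oa ob ba /(model_wfE oa) /(ptmem_wf_sub ba) /(model_wfE ob). Qed.

Lemma model_wf_countable :
  (forall b, b ∈ omega1 -> model_wf lam j b) ->
  forall a, is_ordinal a -> model_wf lam j a.
Proof.
move=> H a oa; apply/(model_wfE oa); apply: ptmem_wf_countable oa => b bo.
by apply/(model_wfE (ord_in omega1_ord bo)); exact: H.
Qed.

End Support.

Theorem proposition3p6 (lam j : V) (hj : I3_embedding lam j) :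
  [/\ I3_infty lam j <-> (forall a, is_ordinal a -> model_wf lam j a),
      I3 lam j omega1 <-> model_wf lam j omega1
    & (forall b, b ∈ omega1 -> I3 lam j b) <->
      (forall b, b ∈ omega1 -> model_wf lam j b)] /\
  [<-> I3_infty lam j;
       I3 lam j omega1;
       forall b, b ∈ omega1 -> I3 lam j b].
Proof.
have ord1 b : b ∈ omega1 -> is_ordinal b := ord_in omega1_ord.
have omul a : is_ordinal a -> is_ordinal (ordmul omega a) := ordmul_ord omega_ord.
have I3_model a : is_ordinal a -> I3 lam j a -> model_wf lam j a.
  by move=> oa; exact: (model_wf_sub hj (omul a oa) oa (sub_ordmul_omega oa)).
have all_I3 : (forall b, b ∈ omega1 -> model_wf lam j b) -> I3_infty lam j.
  by move=> H a oa; exact: (model_wf_countable hj H (omul a oa)).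
have below1 : model_wf lam j omega1 -> forall b, b ∈ omega1 -> model_wf lam j b.
  move=> H b bo; apply: (model_wf_sub hj omega1_ord (ord1 b bo)) H.
  by move=> z zb; exact: (ord_trans omega1_ord zb bo).
split; first split; first split.
- by move=> H a oa; exact: I3_model (H a oa).
- by move=> H; apply: all_I3 => b /ord1; exact: H.
- split; first exact: I3_model omega1_ord.
  by move=> /below1 /all_I3; apply; exact: omega1_ord.
- split=> H b bo; first exact: I3_model (ord1 b bo) (H b bo).
  exact: all_I3 H b (ord1 b bo).
tfae.
- by move=> H; exact: H omega1_ord.
- move=> /(I3_model _ omega1_ord) /below1 /all_I3 H b bo; exact: H (ord1 b bo).
- by move=> H; apply: all_I3 => b bo; exact: I3_model (ord1 b bo) (H b bo).
Qed.
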